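(* Assume that for every $i\in\mathcal S$ the coefficients $A(\cdot,i),B(\cdot,i),C(\cdot,i),D(\cdot,i),Q(\cdot,i),S(\cdot,i),R(\cdot,i)$ are bounded and $\mathbb F^W$-progressively measurable, $G(i)$ is bounded and $\mathscr F^W_T$-measurable, and $Q(\cdot,i),R(\cdot,i),G(i)$ are symmetric. For any given $t\in[0,T]$ and $\vartheta\in L^2_{\mathscr F^\alpha_t}(\Omega;\mathcal S)$, if Problem (M-SLQ) is solvable at the initial time $t$, then there is an $\mathbb F$-adapted process $P:[0,T]\times\mathcal S\times\Omega\to\mathbb S^n$ such that $$V(t,\xi,\vartheta)=\langle P(t,\vartheta)\xi,\xi\rangle,\qquad\forall\,\xi\in L^\infty_{\mathscr F_t}(\Omega;\mathbb R^n).$$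
   Context: Fix $T>0$ and positive integers $n,m,L$. $(\Omega,\mathscr F,\mathbb F,\mathbb P)$ is a complete filtered probability space carrying a standard one-dimensional Brownian motion $W$ and an independent continuous-time Markov chain $\alpha$ with finite state space $\mathcal S=\{1,\dots,L\}$ and generator $[\lambda_{kl}(t)]_{k,l\in\mathcal S}$. $\mathbb F=\{\mathscr F_t\}$ is the natural filtration of $(W,\alpha)$, with $\mathscr F_0$ containing all $\mathbb P$-null sets; $\mathbb F^W=\{\mathscr F^W_t\}$ and $\mathbb F^\alpha=\{\mathscr F^\alpha_t\}$ are the filtrations generated by $W$ and by $\alpha$. $\mathbb S^n$ is the set of symmetric $n\times n$ matrices; $L^\infty_{\mathscr F_t}(\Omega;\mathbb R^n)$ is the set of bounded $\mathscr F_t$-measurable random vectors; $L^2_{\mathbb F}(t,T;\mathbb H)$ is the set of $\mathbb H$-valued $\mathbb F$-progressively measurable processes $\phi$ with $\mathbb E\int_t^T|\phi|^2ds<\infty$. $A(s,i),C(s,i)$ are $\mathbb R^{n\times n}$-valued, $B(s,i),D(s,i)$ are $\mathbb R^{n\times m}$-valued, $Q(s,i)$ and $G(i)$ are $\mathbb R^{n\times n}$-valued, $S(s,i)$ is $\mathbb R^{m\times n}$-valued and $R(s,i)$ is $\mathbb R^{m\times m}$-valued; all are random. $\mathcal D$ is the set of initial triples $(t,\xi,\vartheta)$ with $t\in[0,T]$, $\xi\in L^2_{\mathscr F_t}(\Omega;\mathbb R^n)$, $\vartheta\in L^2_{\mathscr F^\alpha_t}(\Omega;\mathcal S)$; $\mathcal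 U[t,T]=L^2_{\mathbb F}(t,T;\mathbb R^m)$. For $(t,\xi,\vartheta)\in\mathcal D$ and $u\in\mathcal U[t,T]$ the state $X$ solves $$dX=[A(s,\alpha(s))X+B(s,\alpha(s))u]ds+[C(s,\alpha(s))X+D(s,\alpha(s))u]dW(s),\quad X(t)=\xi,\ \alpha(t)=\vartheta,$$ and the cost functional is $$J(t,\xi,\vartheta;u)=\mathbb E\Big[\langle G(\alpha(T))X(T),X(T)\rangle+\int_t^T\big\{\langle QX,X\rangle+2\langle SX,u\rangle+\langle Ru,u\rangle\big\}ds\,\Big|\,\mathscr F_t\Big],$$ with $Q,S,R$ evaluated at $(s,\alpha(s))$. Problem (M-SLQ): given $(t,\xi,\vartheta)\in\mathcal D$, find $u^*\in\mathcal U[t,T]$ with $J(t,\xi,\vartheta;u^* )=\operatorname{ess\,inf}_{u\in\mathcal U[t,T]}J(t,\xi,\vartheta;u)=:V(t,\xi,\vartheta)$; $V$ is the stochastic value flow. The problem is solvable at the initial time $t$ if such a $u^*$ exists for every initial triple with first component $t$. *)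

(* Defs.v *)
From Stdlib Require List.
From HB Require Import structures.
From mathcomp Require Import all_boot all_order all_algebra.
From mathcomp Require Import all_classical all_reals all_analysis.
(* [all_analysis] does not export the measurable structure of \bar R *)
From mathcomp Require Import measurable_realfun.
Set Implicit Arguments.
Unset Strict Implicit.
Unset Printing Implicit Defensive.
Import Order.TTheory GRing.Theory Num.Theory.
Import numFieldNormedType.Exports.
Local Open Scope classical_set_scope.
Local Open Scope ring_scope.

(* Processes are curried as time -> sample point -> value and are only ever
   constrained on [0, T].  A filtration is a map time -> set of events, each of
   whose values will be a sigma-algebra; measurability with respect to the
   sub-sigma-algebra [G] is [measurable_fun] out of [g_sigma_algebraType G].
   Matrix-valued random variables and processes are treated entrywise. *)

Section Basis.
Context {R : realType} {d : measure_display} {Om : measurableType d}.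
Variable P : probability Om R.
Implicit Types (G : set (set Om)) (Fl : R -> set (set Om)).

Definition rv_measurable G (f : Om -> R) : Prop :=
  measurable_fun setT (f : g_sigma_algebraType G -> R).

Definition rv_measurable_mx G (p q : nat) (f : Om -> 'M[R]_(p, q)) : Prop :=
  forall i j, rv_measurable G (fun w => f w i j).

Definition adapted_mx Fl (a b : R) (p q : nat) (f : R -> Om -> 'M[R]_(p, q)) :
    Prop :=
  forall s, a <= s <= b -> rv_measurable_mx (Fl s) (f s).

(* joint measurability on [a, s] x Om for Borel([a, s]) (x) Fl s *)
Definition progressive Fl (a b : R) (f : R -> Om -> R) : Prop :=
  forall s, a <= s <= b ->
    measurable_fun (`[a, s] `*` [set: g_sigma_algebraType (Fl s)])
      (fun z : R * g_sigma_algebraType (Fl s) => f z.1 z.2).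

Definition progressive_mx Fl (a b : R) (p q : nat)
    (f : R -> Om -> 'M[R]_(p, q)) : Prop :=
  forall i j, progressive Fl a b (fun s w => f s w i j).

Definition rv_bounded (f : Om -> R) : Prop :=
  exists K : R, {ae P, forall w, `|f w| <= K}.

Definition rv_bounded_mx (p q : nat) (f : Om -> 'M[R]_(p, q)) : Prop :=
  forall i j, rv_bounded (fun w => f w i j).

Definition bounded_process_mx (a b : R) (p q : nat)
    (f : R -> Om -> 'M[R]_(p, q)) : Prop :=
  exists K : R, {ae P, forall w,
    forall s, a <= s <= b -> forall i j, `|f s w i j| <= K}.

Definition rv_sqint (f : Om -> R) : Prop :=
  (\int[P]_w ((f w) ^+ 2)%:E < +oo)%E.

Definition energy (a b : R) (f : R -> Om -> R) : \bar R :=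
  (\int[P]_w \int[lebesgue_measure]_(s in `[a, b]) ((f s w) ^+ 2)%:E)%E.

Definition L2F Fl (a b : R) (f : R -> Om -> R) : Prop :=
  progressive Fl a b f /\ (energy a b f < +oo)%E.

Definition L2F_mx Fl (a b : R) (p q : nat) (f : R -> Om -> 'M[R]_(p, q)) :
    Prop :=
  forall i j, L2F Fl a b (fun s w => f s w i j).

(* [Y] is a version of E[Z | G] *)
Definition is_condexp G (Z Y : Om -> R) : Prop :=
  [/\ P.-integrable setT (EFin \o Z),
      P.-integrable setT (EFin \o Y),
      rv_measurable G Y &
      forall A, G A ->
        (\int[P]_(w in A) (Y w)%:E = \int[P]_(w in A) (Z w)%:E)%E].

(* [V] is the essential infimum of the family [Ys] of random variables (their
   greatest lower bound for the almost-sure order); this is not the [ess_inf]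
   of the library, which is that of a single function. *)
Definition is_essinf (Ys : set (Om -> R)) (V : Om -> \bar R) : Prop :=
  [/\ measurable_fun setT V,
      forall Y, Ys Y -> {ae P, forall w, (V w <= (Y w)%:E)%E} &
      forall Z : Om -> \bar R, measurable_fun setT Z ->
        (forall Y, Ys Y -> {ae P, forall w, (Z w <= (Y w)%:E)%E}) ->
        {ae P, forall w, (Z w <= V w)%E}].

(* Filtrations generated by a real process, by a finite-state process, and by
   both, augmented with the P-null sets. *)
Definition real_events (W : R -> Om -> R) (s : R) : set (set Om) :=
  [set E | exists r (U : set R),
    [/\ 0 <= r <= s, measurable U & E = W r @^-1` U]].

Definition state_events (L : nat) (alpha : R -> Om -> 'I_L) (s : R) :
    set (set Om) :=
  [set E | exists r (l : 'I_L), 0 <= r <= s /\ E = alpha r @^-1` [set l]].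

Definition null_events : set (set Om) := [set E | P.-negligible E].

Definition filtW (W : R -> Om -> R) (s : R) : set (set Om) :=
  <<s real_events W s `|` null_events >>.

Definition filtA (L : nat) (alpha : R -> Om -> 'I_L) (s : R) : set (set Om) :=
  <<s state_events alpha s `|` null_events >>.

Definition filtWA (L : nat) (W : R -> Om -> R) (alpha : R -> Om -> 'I_L)
    (s : R) : set (set Om) :=
  <<s real_events W s `|` state_events alpha s `|` null_events >>.

Definition increment (W : R -> Om -> R) (r s : R) (w : Om) : R :=
  W s w - W r w.

Definition brownian_motion (T : R) (W : R -> Om -> R) : Prop :=
  [/\ forall s, 0 <= s <= T -> measurable_fun setT (W s),
      {ae P, forall w, W 0 w = 0},
      {ae P, forall w, {within `[0, T], continuous (fun s => W s w)}},
      forall r s (U : set R), 0 <= r -> r < s -> s <= T -> measurable U ->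
        P (increment W r s @^-1` U) = normal_prob 0 (Num.sqrt (s - r)) U &
      forall r s (U : set R) A, 0 <= r -> r < s -> s <= T -> measurable U ->
        filtW W r A ->
        P (A `&` increment W r s @^-1` U)
          = (P A * P (increment W r s @^-1` U))%E].

(* [tp r s k l] is the probability of moving from [k] at time [r] to [l] at
   time [s], for a chain whose generator at time [r] is [lam k l r]. *)
Definition transition_function (T : R) (L : nat) (lam : 'I_L -> 'I_L -> R -> R)
    (tp : R -> R -> 'I_L -> 'I_L -> R) : Prop :=
  [/\ forall r s k l, 0 <= r -> r <= s -> s <= T -> 0 <= tp r s k l,
      forall r s k, 0 <= r -> r <= s -> s <= T -> \sum_l tp r s k l = 1,
      forall r k l, 0 <= r <= T -> tp r r k l = (k == l)%:R,
      forall r v s k l, 0 <= r -> r <= v -> v <= s -> s <= T ->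
        tp r s k l = \sum_j tp r v k j * tp v s j l &
      forall r k l, 0 <= r < T ->
        (tp r (r + h) k l - (k == l)%:R) / h @[h --> 0^'+] --> lam k l r].

(* Chain on [t0, T] with transition function [tp], Markov with respect to
   [Fl]; the third clause says that almost every path is right-continuous with
   left limits for the discrete topology.  The first clause includes
   adaptedness; the joint measurability it adds is a consequence of the third
   up to redefining the chain on a null set. *)
Definition markov_chain Fl (t0 T : R) (L : nat)
    (tp : R -> R -> 'I_L -> 'I_L -> R) (beta : R -> Om -> 'I_L) : Prop :=
  [/\ forall l, progressive Fl t0 T (fun s w => (beta s w == l)%:R),
      forall r s l, t0 <= r -> r <= s -> s <= T ->
        is_condexp (Fl r) (fun w => (beta s w == l)%:R)
          (fun w => tp r s (beta r w) l) &
      {ae P, forall w,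
        (forall s, t0 <= s < T -> \forall r \near s^'+, beta r w = beta s w) /\
        (forall s, t0 < s <= T ->
           exists l, \forall r \near s^'-, beta r w = l)}].

Definition independent_filtrations (T : R) (F1 F2 : R -> set (set Om)) : Prop :=
  forall A B, F1 T A -> F2 T B -> P (A `&` B) = (P A * P B)%E.

(* The Ito integral of an integrand in L2F is the L2 limit of the elementary
   integrals of simple integrands
     sum_c height_c 1_{]lo_c, hi_c]},  height_c bounded and Fl lo_c-measurable;
   the intervals need not be disjoint, so simple integrands are closed under
   concatenation. *)
Record step := Step { lo : R; hi : R; height : Om -> R }.

Definition step_ok Fl (a b : R) (c : step) : Prop :=
  [/\ a <= lo c, lo c <= hi c, hi c <= b,
      rv_measurable (Fl (lo c)) (height c) & rv_bounded (height c)].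

Definition simple_val (cs : seq step) (s : R) (w : Om) : R :=
  \sum_(c <- cs) height c w * (lo c < s <= hi c)%R%:R.

Definition simple_int (W : R -> Om -> R) (cs : seq step) (s : R) (w : Om) : R :=
  \sum_(c <- cs) height c w *
    (W (Num.min (hi c) s) w - W (Num.min (lo c) s) w).

(* [I s] is a continuous version of the Ito integral of [f] from [a] to [s],
   for s in [a, b] *)
Definition is_ito Fl (W : R -> Om -> R) (a b : R) (f I : R -> Om -> R) : Prop :=
  [/\ L2F Fl a b f,
      forall s, a <= s <= b -> rv_measurable (Fl s) (I s),
      {ae P, forall w, {within `[a, b], continuous (fun s => I s w)}} &
      exists cs : nat -> seq step,
        [/\ forall k, List.Forall (step_ok Fl a b) (cs k),
            (energy a b (fun s w => f s w - simple_val (cs k) s w)%R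
              @[k --> \oo] --> 0)%E &
            forall s, a <= s <= b ->
              (\int[P]_w ((I s w - simple_int W (cs k) s w) ^+ 2)%:E
                @[k --> \oo] --> 0)%E]].

End Basis.

Definition dotp (R : realType) (n : nat) (x y : 'cV[R]_n) : R :=
  \sum_i x i 0 * y i 0.

Section SLQ.
Context {R : realType} {d : measure_display} {Om : measurableType d}.
Variables (n m L : nat).

Record coefficients := Coefficients {
  cA : R -> 'I_L -> Om -> 'M[R]_n;
  cB : R -> 'I_L -> Om -> 'M[R]_(n, m);
  cC : R -> 'I_L -> Om -> 'M[R]_n;
  cD : R -> 'I_L -> Om -> 'M[R]_(n, m);
  cQ : R -> 'I_L -> Om -> 'M[R]_n;
  cS : R -> 'I_L -> Om -> 'M[R]_(m, n);
  cR : R -> 'I_L -> Om -> 'M[R]_m;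
  cG : 'I_L -> Om -> 'M[R]_n }.

Variables (P : probability Om R) (T : R).

Definition admissible_coefficients (FW : R -> set (set Om))
    (k : coefficients) : Prop :=
  let ok p q (f : R -> Om -> 'M[R]_(p, q)) :=
    progressive_mx FW 0 T f /\ bounded_process_mx P 0 T f in
  forall i,
    [/\ [/\ ok _ _ (cA k ^~ i), ok _ _ (cB k ^~ i), ok _ _ (cC k ^~ i) &
            ok _ _ (cD k ^~ i)],
        [/\ ok _ _ (cQ k ^~ i), ok _ _ (cS k ^~ i) & ok _ _ (cR k ^~ i)],
        rv_measurable_mx (FW T) (cG k i) /\ rv_bounded_mx P (cG k i),
        forall s w, 0 <= s <= T ->
          (cQ k s i w)^T = cQ k s i w /\ (cR k s i w)^T = cR k s i w &
        forall w, (cG k i w)^T = cG k i w].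

Variables (W : R -> Om -> R) (alpha : R -> Om -> 'I_L).
Variable tp : R -> R -> 'I_L -> 'I_L -> R.

(* The state equation started at time [t] is driven by a chain equal to
   [theta] at time [t].  [al t theta] denotes that chain; it coincides with
   [alpha] when theta = alpha(t). *)
Variable al : R -> (Om -> 'I_L) -> R -> Om -> 'I_L.
Variable k : coefficients.

Let F := filtWA P W alpha.
Let FA := filtA P alpha.

Definition restarts_chain : Prop :=
  forall t theta, 0 <= t <= T -> {ae P, forall w, theta w = alpha t w} ->
    forall s, t <= s <= T -> al t theta s = alpha s.

(* [theta] is an FA(t)-measurable S-valued variable (square-integrability is
   automatic, S being finite) and [al t theta] is indeed an FA-adapted chain on
   [t, T] with the transition function of [alpha] and initial value [theta].
   The latter is a condition because the filtration generated by [alpha] need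
   not carry a chain started from every [theta]. *)
Definition initial_regime (t : R) (theta : Om -> 'I_L) : Prop :=
  [/\ forall l, FA t (theta @^-1` [set l]),
      markov_chain P FA t T tp (al t theta) &
      {ae P, forall w, al t theta t w = theta w}].

Definition initial_triple (t : R) (xi : Om -> 'cV[R]_n) (theta : Om -> 'I_L) :
    Prop :=
  [/\ 0 <= t <= T,
      rv_measurable_mx (F t) xi /\ (forall i, rv_sqint P (fun w => xi w i 0)) &
      initial_regime t theta].

Definition control (t : R) (u : R -> Om -> 'cV[R]_m) : Prop :=
  L2F_mx P F t T u.

(* [X] solves the state equation on [t, T]: it is continuous,
   square-integrable, and satisfies the integral equation. *)
Definition is_state (t : R) (xi : Om -> 'cV[R]_n) (theta : Om -> 'I_L)
    (u : R -> Om -> 'cV[R]_m) (X : R -> Om -> 'cV[R]_n) : Prop :=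
  let a := al t theta in
  let drift s w := cA k s (a s w) w *m X s w + cB k s (a s w) w *m u s w in
  let diffusion s w := cC k s (a s w) w *m X s w + cD k s (a s w) w *m u s w in
  [/\ L2F_mx P F t T X,
      forall s i, t <= s <= T -> rv_sqint P (fun w => X s w i 0),
      {ae P, forall w, forall i,
        {within `[t, T], continuous (fun s => X s w i 0)}} &
      exists I : R -> Om -> 'cV[R]_n,
        (forall i, is_ito P F W t T (fun s w => diffusion s w i 0)
                                    (fun s w => I s w i 0)) /\
        {ae P, forall w, forall s, t <= s <= T -> forall i,
          X s w i 0 = xi w i 0
            + \int[lebesgue_measure]_(r in `[t, s]) drift r w i 0
            + I s w i 0}].

Definition cost_integrand (t : R) (theta : Om -> 'I_L)
    (u : R -> Om -> 'cV[R]_m) (X : R -> Om -> 'cV[R]_n) (s : R) (w : Om) : R :=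
  let i := al t theta s w in
  dotp (cQ k s i w *m X s w) (X s w)
  + 2 * dotp (cS k s i w *m X s w) (u s w)
  + dotp (cR k s i w *m u s w) (u s w).

Definition pathwise_cost (t : R) (theta : Om -> 'I_L)
    (u : R -> Om -> 'cV[R]_m) (X : R -> Om -> 'cV[R]_n) (w : Om) : R :=
  dotp (cG k (al t theta T w) w *m X T w) (X T w)
  + \int[lebesgue_measure]_(s in `[t, T]) cost_integrand t theta u X s w.

(* [J] is a version of J(t, xi, theta; u).  Solutions of the linear state
   equation being unique up to indistinguishability, the choice of [X] is
   immaterial. *)
Definition is_cost (t : R) (xi : Om -> 'cV[R]_n) (theta : Om -> 'I_L)
    (u : R -> Om -> 'cV[R]_m) (J : Om -> R) : Prop :=
  exists X, is_state t xi theta u X /\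
    is_condexp P (F t) (pathwise_cost t theta u X) J.

(* [V] is a version of the stochastic value flow V(t, xi, theta) *)
Definition is_value (t : R) (xi : Om -> 'cV[R]_n) (theta : Om -> 'I_L)
    (V : Om -> \bar R) : Prop :=
  is_essinf P [set J | exists u, control t u /\ is_cost t xi theta u J] V.

Definition optimal (t : R) (xi : Om -> 'cV[R]_n) (theta : Om -> 'I_L)
    (u : R -> Om -> 'cV[R]_m) : Prop :=
  control t u /\
  exists J, is_cost t xi theta u J /\ is_value t xi theta (EFin \o J).

Definition solvable_at (t : R) : Prop :=
  forall xi theta, initial_triple t xi theta ->
    exists u, optimal t xi theta u.

End SLQ.

(* Main.v *)
Require Import Defs.
From mathcomp Require Import all_boot all_order all_algebra.
From mathcomp Require Import all_classical all_reals all_analysis.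
From mathcomp Require Import measurable_realfun.
From mathcomp Require Import ring lra.
Set Implicit Arguments.
Unset Strict Implicit.
Unset Printing Implicit Defensive.
Import Order.TTheory GRing.Theory Num.Theory.
Import numFieldNormedType.Exports.
Local Open Scope classical_set_scope.
Local Open Scope ring_scope.

(** The state equation is linear and the cost quadratic, and this structure is
    compatible with conditioning on the information available at the initial
    time [t]: a bounded variable measurable at time [t] can be pulled out of
    Lebesgue integrals, Ito integrals and conditional expectations.  Hence
    pairs (control, state) can be superposed with such random coefficients
    ([admissible_lin], resting on [ito_lin]), and the conditional expectation
    of the bilinear form [cost_form], whose diagonal is the cost, is bilinear
    over them ([cost_version_linl] and [cost_version_linr], resting on
    [condexp_linear]).

    Solvability provides an optimal pair [z i] for each vector [e_i] of the
    canonical basis.  For an initial state [xi = \sum_i xi_i e_i], consider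
    the superposition [zeta = \sum_i xi_i (z i)], which starts from [xi].  Its
    cost is the quadratic form in [xi] with coefficients [Y i j], the
    conditional expectations of [cost_form (z i) (z j)].  So it is enough to
    see that [zeta] is optimal.  A competitor starting from [xi] is [zeta + z0]
    with [z0] starting from 0.  Since [z i + x z0] starts from [e_i] for every
    real [x] and [z i] is optimal, the conditional cost of [z0] is nonnegative
    and its cross terms with [z i] cancel ([optimal_first_order]); by
    bilinearity the cross terms with [zeta] cancel as well, and the competitor
    costs at least as much as [zeta] ([value_quadratic]).

    The states occurring in this argument are superpositions and differences
    of states that the hypotheses provide, and solve their equations by
    linearity.  Essentially bounded initial states are first modified on a
    null set to become bounded. *)

(** * Conditional expectation *)

Section CondExp.
Import HBNNSimple.
Context {R : realType} {d : measure_display} {Om : measurableType d}.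
Variable P : probability Om R.
Variable G : set (set Om).
Hypothesis G_sigma : sigma_algebra setT G.
Hypothesis G_meas : G `<=` measurable.

Let sub_measurableE : (measurable : set (set (g_sigma_algebraType G))) = G.
Proof. exact: sigma_algebra_id. Qed.

Lemma sub_eventP (A : set Om) :
  G A <-> measurable (A : set (g_sigma_algebraType G)).
Proof. by rewrite sub_measurableE. Qed.

Lemma sub_measurable (A : set Om) : G A -> measurable A.
Proof. exact: G_meas. Qed.

Lemma measurable_to_sub :
  measurable_fun setT (id : Om -> g_sigma_algebraType G).
Proof.
move=> _ A; rewrite sub_measurableE setTI preimage_id => GA.
exact: sub_measurable.
Qed.

Lemma rv_measurable_fun (f : Om -> R) : rv_measurable G f ->
  measurable_fun setT f.
Proof. by move=> mf; exact: (measurableT_comp mf measurable_to_sub). Qed.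

(** The coarse sigma-algebra contains the level sets of [g], on each of which
    the integral of [g D] is a multiple of an integral of [D]. *)
Let integral0_simple (D : Om -> R)
    (g : {nnsfun (g_sigma_algebraType G) >-> R}) (A : set Om) :
  P.-integrable setT (EFin \o D) ->
  (forall B, G B -> (\int[P]_(w in B) (D w)%:E = 0)%E) -> G A ->
  (\int[P]_(w in A) (g w * D w)%:E = 0)%E.
Proof.
move=> iD D0 GA; have mA := sub_measurable GA.
have gG y : G (g @^-1` [set y]).
  apply/sub_eventP; rewrite -[X in measurable X]setTI.
  exact: (@measurable_funPT _ _ _ _ g).
pose s : seq R := finmap.enum_fset (fset_set (range g)).
transitivity (\int[P]_(w in A)
    (\sum_(y <- s) y%:E * ((D \_ (g @^-1` [set y])) w)%:E))%E.
  apply: eq_integral => w _.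
  rewrite {1}(fimfunE g) fsbig_finite//= big_distrl/= -sumEFin.
  apply: eq_bigr => y _; rewrite -EFinM; congr EFin.
  by rewrite patch_indic/= -mulrA [\1__ _ * _]mulrC.
have iDy y : P.-integrable A (EFin \o (D \_ (g @^-1` [set y]))).
  rewrite -restrict_EFin; apply: (integrableS measurableT) => //.
  apply/(integrable_mkcond _ (sub_measurable (gG y))).1.
  by apply: (integrableS measurableT) => //; exact: sub_measurable.
rewrite (@integral_sum _ _ _ P A mA _
    (fun y w => y%:E * ((D \_ (g @^-1` [set y])) w)%:E)%E); last first.
  by move=> y; apply: (integrableZl mA _ (iDy y)).
apply: big1 => y _; rewrite integralZl//; last exact: (iDy y).
rewrite (_ : (\int[P]_(w in A) _)%E = 0%E) ?mule0//.
rewrite -[LHS]/(\int[P]_(w in A) (EFin \o (D \_ (g @^-1` [set y]))) w)%E.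
rewrite -restrict_EFin.
rewrite -integral_mkcondr; apply: D0.
by apply/sub_eventP; apply: measurableI; apply/sub_eventP.
Qed.

(** The step from integrals over events to integrals against weights, from
    which the pull-out property of conditional expectations follows: simple
    weights are combinations of events, nonnegative bounded ones are limits of
    simple ones, and adding [K] makes a weight bounded by [K] nonnegative. *)
Lemma integral0_pullout (c D : Om -> R) (K : R) (A : set Om) :
  P.-integrable setT (EFin \o D) ->
  (forall B, G B -> (\int[P]_(w in B) (D w)%:E = 0)%E) ->
  rv_measurable G c -> (forall w, `|c w| <= K) -> G A ->
  (\int[P]_(w in A) (c w * D w)%:E = 0)%E.
Proof.
move=> iD D0 mc cK GA; have mA := sub_measurable GA.
have mD : measurable_fun setT D.
  by apply/measurable_EFinP; exact: measurable_int iD.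
have iDA : P.-integrable A (EFin \o D) by exact: (integrableS measurableT).
have ge0_case (b : Om -> R) (M : R) : rv_measurable G b ->
    (forall w, 0 <= b w <= M) -> P.-integrable A (fun w => (b w * D w)%:E) /\
    (\int[P]_(w in A) (b w * D w)%:E = 0)%E.
  move=> mb bM.
  have meb : measurable_fun [set: g_sigma_algebraType G] (EFin \o b).
    exact/measurable_EFinP.
  have eb0 (w : g_sigma_algebraType G) : [set: g_sigma_algebraType G] w ->
      (0 <= (EFin \o b) w)%E.
    by move=> _; rewrite lee_fin; case/andP: (bM w).
  pose g := nnsfun_approx measurableT meb.
  have mg n : measurable_fun setT (g n : Om -> R).
    by apply: rv_measurable_fun; exact: (@measurable_funPT _ _ _ _ (g n)).
  have [] := @dominated_convergence _ _ _ P A mA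
    (fun n w => (g n w * D w)%:E) (fun w => (b w * D w)%:E)
    (fun w => M%:E * `|(D w)%:E|)%E.
  - by move=> n; apply/measurable_EFinP/measurable_funTS/measurable_funM.
  - apply/measurable_EFinP/measurable_funTS/measurable_funM => //.
    exact: rv_measurable_fun.
  - apply: aeW => w Aw; rewrite EFinM.
    under eq_fun do rewrite EFinM.
    by apply: cvgeZr => //; exact: (cvg_nnsfun_approx measurableT meb eb0).
  - by apply: integrableZl => //; exact: (integrable_abse iDA).
  - apply: aeW => w n Aw; rewrite EFinM abseM lee_wpmul2r//.
    rewrite gee0_abs ?lee_fin//.
    case/andP: (bM w) => _; apply: le_trans; rewrite -lee_fin.
    rewrite nnsfun_approxE; exact: (le_approx n eb0).
  move=> ib _ lim0; split => //.
  apply/esym; move: lim0; apply: cvg_unique => //.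
  rewrite (_ : [sequence _]_n = cst 0%E); first exact: cvg_cst.
  by apply/funext => n /=; exact: integral0_simple.
(* [c + K] takes its values in [[0, 2 K]]. *)
have [iK K0] : P.-integrable A (fun w => ((c w + K) * D w)%:E) /\
    (\int[P]_(w in A) ((c w + K) * D w)%:E = 0)%E.
  apply: (ge0_case _ (K + K)).
    by apply: (@measurable_funD _ (g_sigma_algebraType G)).
  move=> w; have := cK w; rewrite ler_norml => /andP[h1 h2].
  by rewrite -lerBlDr sub0r h1 lerD2r.
have -> : (\int[P]_(w in A) (c w * D w)%:E =
    \int[P]_(w in A) (((c w + K) * D w)%:E - (K%:E * (D w)%:E)))%E.
  by apply: eq_integral => w _; rewrite -EFinM -EFinB -mulrBl addrK.
rewrite integralB//; last exact: integrableZl.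
by rewrite K0 integralZl// D0// mule0 sube0.
Qed.

(** The restriction of [P] to [G] is the law of the identity, seen as a variable
    with values in the space equipped with [G].  Uniqueness of densities and
    the Radon-Nikodym theorem for this law are statements about conditional
    expectations given [G]. *)
Let incl_subproof : (id : Om -> g_sigma_algebraType G) \in mfun.
Proof. by rewrite inE; exact: measurable_to_sub. Qed.

Let incl : {mfun Om >-> g_sigma_algebraType G} := mfun_Sub incl_subproof.

Let Q : probability (g_sigma_algebraType G) R := distribution P incl.

Let integral_sub (f : Om -> \bar R) (A : set Om) :
  measurable_fun [set: g_sigma_algebraType G] f -> P.-integrable setT f ->
  G A -> (\int[Q]_(w in A) f w = \int[P]_(w in A) f w)%E.
Proof.
move=> mf fi GA.
have mA : measurable (A : set (g_sigma_algebraType G)) by apply/sub_eventP.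
have iA : P.-integrable A f.
  by apply: (integrableS measurableT) => //; exact: sub_measurable.
exact: (@integral_pushforward _ _ _ _ R incl measurable_to_sub P A f mf iA mA).
Qed.

Let integrable_sub (f : Om -> \bar R) :
  measurable_fun [set: g_sigma_algebraType G] f ->
  P.-integrable setT f <-> Q.-integrable setT f.
Proof.
move=> mf; split=> [fi|/integrableP[_ fy]].
  exact: (@integrable_pushforward _ _ _ _ R incl measurable_to_sub P setT f mf
    fi measurableT).
apply/integrableP; split; first exact: (measurableT_comp mf measurable_to_sub).
move: fy; rewrite (@ge0_integral_pushforward _ _ _ _ _ incl)//.
exact: measurableT_comp.
Qed.

Let ae_sub (S : set Om) : {ae Q, forall w, S w} -> {ae P, forall w, S w}.
Proof.
move=> [N [mN N0 sN]]; exists N; split => //.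
by apply: sub_measurable; apply/sub_eventP.
Qed.

(** Both versions are densities, with respect to the restriction of [P] to [G],
    of the same set function. *)
Lemma condexp_uniq (Z Z' Y Y' : Om -> R) :
  is_condexp P G Z Y -> is_condexp P G Z' Y' ->
  {ae P, forall w, Z w = Z' w} -> {ae P, forall w, Y w = Y' w}.
Proof.
move=> [iZ iY mY ZY] [iZ' iY' mY' ZY'] ZZ'.
suff : ae_eq Q setT (EFin \o Y) (EFin \o Y').
  by move=> YY'; apply: ae_sub; apply: filterS YY' => w /(_ I) [].
have meY : measurable_fun [set: g_sigma_algebraType G] (EFin \o Y).
  exact/measurable_EFinP.
have meY' : measurable_fun [set: g_sigma_algebraType G] (EFin \o Y').
  exact/measurable_EFinP.
apply: integral_ae_eq => //; first exact/integrable_sub.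
move=> A _ /sub_eventP GA; have mA := sub_measurable GA.
rewrite !integral_sub// [LHS]ZY// [RHS]ZY'//.
apply: ae_eq_integral => //.
- exact/measurable_funTS/(measurable_int _ iZ).
- exact/measurable_funTS/(measurable_int _ iZ').
- by apply: filterS ZZ' => w /= ->.
Qed.

Lemma condexp_ae (Z Z' Y : Om -> R) : is_condexp P G Z Y ->
  P.-integrable setT (EFin \o Z') -> {ae P, forall w, Z w = Z' w} ->
  is_condexp P G Z' Y.
Proof.
move=> [iZ iY mY ZY] iZ' ZZ'; split => // A GA; rewrite ZY//.
have mA := sub_measurable GA; apply: ae_eq_integral => //.
- exact/measurable_funTS/(measurable_int _ iZ).
- exact/measurable_funTS/(measurable_int _ iZ').
- by apply: filterS ZZ' => w /= ->.
Qed.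

(** The set function [A |-> E[Z 1_A]] on [G] is absolutely continuous with
    respect to the restriction of [P], and its density is the conditional
    expectation. *)
Lemma condexp_exists (Z : Om -> R) : P.-integrable setT (EFin \o Z) ->
  exists Y, is_condexp P G Z Y.
Proof.
move=> iZ.
pose nu : {charge set (g_sigma_algebraType G) -> \bar R} :=
  measure_function_pushforward__canonical__charge_Charge
    (induced_charge iZ) (measurable_to_sub).
have nuQ : nu `<< Q.
  apply/null_content_dominatesP => A mA QA0.
  have ZA : measurable_fun (A : set Om) (EFin \o Z).
    exact/measurable_funTS/(measurable_int _ iZ).
  apply: null_set_integral => //; apply: sub_measurable; exact/sub_eventP.
pose Y w := fine (Radon_Nikodym nu Q w).
have YE : EFin \o Y = Radon_Nikodym nu Q.
  by apply/funext => w /=; rewrite /Y fineK//; exact: Radon_Nikodym_fin_num.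
have iQ : Q.-integrable setT (EFin \o Y).
  by rewrite YE; exact: Radon_Nikodym_integrable.
have meY := measurable_int _ iQ.
have iP : P.-integrable setT (EFin \o Y) by apply/integrable_sub.
exists Y; split => //; first exact/measurable_EFinP.
move=> A GA; rewrite -[LHS]integral_sub// -/(EFin \o Y) YE.
rewrite -Radon_Nikodym_integral//.
exact/sub_eventP.
Qed.

(** Additivity and the pull-out property at once: superpositions are built by
    steps [c Z + Z'], so that this is the form in which both are applied. *)
Lemma condexp_linear (c Z Z' Y Y' : Om -> R) (K : R) :
  rv_measurable G c -> (forall w, `|c w| <= K) ->
  is_condexp P G Z Y -> is_condexp P G Z' Y' ->
  is_condexp P G (fun w => c w * Z w + Z' w) (fun w => c w * Y w + Y' w).
Proof.
move=> mc cK [iZ iY mY ZY] [iZ' iY' mY' ZY'].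
have mc' := rv_measurable_fun mc.
have icM (f : Om -> R) : P.-integrable setT (EFin \o f) ->
    P.-integrable setT (fun w => (c w * f w)%:E).
  move=> fi.
  have := @integrableMr _ _ _ P setT measurableT c (EFin \o f) mc' _ fi.
  apply; exists K; split; first exact: num_real.
  by move=> x Kx w _ /=; exact: le_trans (cK w) (ltW Kx).
split.
- by apply: (@integrableD _ _ _ P setT measurableT _ _ (icM Z iZ) iZ').
- by apply: (@integrableD _ _ _ P setT measurableT _ _ (icM Y iY) iY').
- apply: measurable_funD => //; exact: measurable_funM.
move=> A GA; have mA := sub_measurable GA.
have iS (f : Om -> \bar R) : P.-integrable setT f -> P.-integrable A f.
  by move=> fi; exact: (integrableS measurableT).
under eq_integral do rewrite EFinD.
under [RHS]eq_integral do rewrite EFinD.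
rewrite !integralD//;
  [|exact: iS..|exact: iS (icM _ _)|exact: iS|exact: iS (icM _ _)|exact: iS].
congr (_ + _)%E; last exact: ZY'.
have iD : P.-integrable setT (fun w => (Y w - Z w)%:E).
  exact: (@integrableB _ _ _ P setT measurableT _ _ iY iZ).
rewrite (_ : (\int[P]_(w in A) (c w * Y w)%:E =
    \int[P]_(w in A) ((c w * Z w)%:E + (c w * (Y w - Z w))%:E))%E); last first.
  by apply: eq_integral => w _; rewrite -EFinD -mulrDr addrC subrK.
rewrite integralD//; [|exact: iS (icM _ _)..].
rewrite (@integral0_pullout c (fun w => Y w - Z w) K) ?adde0// => B GB.
have mB := sub_measurable GB.
under eq_integral do rewrite EFinB.
rewrite integralB//; [|exact: (integrableS measurableT)..].
rewrite ZY// subee//; apply: integrable_fin_num => //.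
exact: (integrableS measurableT).
Qed.

End CondExp.

(** * Square-integrable processes *)

(** Every moment estimate below is a pointwise bound of this form, integrated
    over time, over the sample space, or over both in turn. *)
Lemma le_ge0_integral_lin d (T : measurableType d) (R : realType)
    (mu : {measure set T -> \bar R}) (D : set T) (h f g : T -> \bar R)
    (x y : R) :
  measurable D -> 0 <= x -> 0 <= y ->
  (forall w, D w -> 0 <= h w)%E -> measurable_fun D h ->
  (forall w, D w -> 0 <= f w)%E -> measurable_fun D f ->
  (forall w, D w -> 0 <= g w)%E -> measurable_fun D g ->
  (forall w, D w -> h w <= x%:E * f w + y%:E * g w)%E ->
  (\int[mu]_(w in D) h w <=
   x%:E * \int[mu]_(w in D) f w + y%:E * \int[mu]_(w in D) g w)%E.
Proof.
move=> mD x0 y0 h0 mh f0 mf g0 mg hfg.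
rewrite -(ge0_integralZl_EFin mu mD f0 mf x0).
rewrite -(ge0_integralZl_EFin mu mD g0 mg y0).
have xf0 w : D w -> (0 <= x%:E * f w)%E by move=> /f0 ?; rewrite mule_ge0.
have yg0 w : D w -> (0 <= y%:E * g w)%E by move=> /g0 ?; rewrite mule_ge0.
have mxf : measurable_fun D (fun w => x%:E * f w)%E by exact: measurable_funeM.
have myg : measurable_fun D (fun w => y%:E * g w)%E by exact: measurable_funeM.
rewrite -(ge0_integralD mu mD xf0 mxf yg0 myg).
by apply: ge0_le_integral => //; exact: emeasurable_funD.
Qed.

Section JointMeasurability.
Context {R : realType} {d : measure_display} {Om : measurableType d}.
Variable P : probability Om R.
Variables a b : R.
Implicit Types (f g h : R -> Om -> R) (c : Om -> R).

Definition jointly_measurable f : Prop :=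
  measurable_fun (`[a, b] `*` [set: Om]) (fun z : R * Om => f z.1 z.2).

Let strip_measurable : measurable (`[a, b] `*` [set: Om] : set (R * Om)).
Proof. exact: measurableX. Qed.

Lemma jointly_measurable_rv c : measurable_fun setT c ->
  jointly_measurable (fun _ w => c w).
Proof.
move=> mc; apply: measurable_funTS.
exact: (measurableT_comp mc (@measurable_snd _ _ _ _)).
Qed.

Lemma jointly_measurableD f g : jointly_measurable f -> jointly_measurable g ->
  jointly_measurable (fun s w => f s w + g s w).
Proof. exact: measurable_funD. Qed.

Lemma jointly_measurableM f g : jointly_measurable f -> jointly_measurable g ->
  jointly_measurable (fun s w => f s w * g s w).
Proof. exact: measurable_funM. Qed.

Lemma jointly_measurable_sum (I : Type) (r : seq I) (F : I -> R -> Om -> R) :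
  (forall i, jointly_measurable (F i)) ->
  jointly_measurable (fun s w => \sum_(i <- r) F i s w).
Proof. by move=> mF; apply: measurable_sum. Qed.

Lemma jointly_measurable_lin c f g : measurable_fun setT c ->
  jointly_measurable f -> jointly_measurable g ->
  jointly_measurable (fun s w => c w * f s w + g s w).
Proof.
move=> mc mf mg; apply: jointly_measurableD => //.
exact: jointly_measurableM (jointly_measurable_rv mc) mf.
Qed.

Lemma jointly_measurable_section f s : a <= s <= b -> jointly_measurable f ->
  measurable_fun setT (f s).
Proof.
move=> sab mf.
apply: (@measurable_comp _ _ _ _ _ _ (`[a, b] `*` [set: Om]) _ _
  (fun w => (s, w)) _ _ mf) => //.
  by move=> _ [w _ <-]; split => //=; rewrite in_itv.
exact: pair1_measurable.
Qed.

Lemma jointly_measurable_path f w : jointly_measurable f ->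
  measurable_fun `[a, b] (f ^~ w).
Proof.
move=> mf.
apply: (@measurable_comp _ _ _ _ _ _ (`[a, b] `*` [set: Om]) _ _
  (fun s : R => (s, w)) _ _ mf) => //.
  by move=> _ [s sab <-].
exact/measurable_funTS/pair2_measurable.
Qed.

(** Extending processes by zero outside [[a, b]] reduces integrals over time to
    integrals over the whole line, so that the Fubini-Tonelli theorems apply to
    the product of [P] with the Lebesgue measure. *)
Let restr f (z : Om * R) : R := \1_(`[a, b]%classic) z.2 * f z.2 z.1.

Let restrE f : restr f =
  (fun z : R * Om => f z.1 z.2) \_ (`[a, b] `*` [set: Om])
    \o (@unstable.swap _ _).
Proof.
apply/funext => -[w s] /=; rewrite /restr patch_indic /= mulrC; congr (_ * _).
by rewrite !indicE in_setX in_setT andbT.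
Qed.

Let measurable_restr f : jointly_measurable f -> measurable_fun setT (restr f).
Proof.
move=> mf; rewrite restrE; apply: measurableT_comp; last exact: measurable_swap.
exact/(measurable_restrictT _ strip_measurable).
Qed.

(** The case [u = id] serves the integral itself, and the cases of the norm and
    of the square serve integrability and energy. *)
Let integral_restr (u : R -> R) : u 0 = 0 -> forall f w,
  (\int[lebesgue_measure]_(s in `[a, b]) (u (f s w))%:E =
   \int[lebesgue_measure]_s (u (restr f (w, s)))%:E)%E.
Proof.
move=> u0 f w; rewrite integral_mkcond; apply: eq_integral => s _.
rewrite /restr /= indicE /patch; case: ifP => _; first by rewrite mul1r.
by rewrite mul0r u0.
Qed.

Lemma measurable_time_integral f (u : R -> R) : measurable_fun setT u ->
  u 0 = 0 -> (forall x, 0 <= u x) -> jointly_measurable f ->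
  measurable_fun setT
    (fun w => \int[lebesgue_measure]_(s in `[a, b]) (u (f s w))%:E)%E.
Proof.
move=> mu u0 u_ge0 mf.
under eq_fun do rewrite (integral_restr u0).
apply: (@measurable_fun_fubini_tonelli_F _ _ _ _ _ lebesgue_measure
  (fun z => (u (restr f z))%:E)).
  by apply/measurable_EFinP/measurableT_comp => //; exact: measurable_restr.
by move=> z; rewrite lee_fin.
Qed.

Lemma measurable_path_energy f : jointly_measurable f ->
  measurable_fun setT
    (fun w => \int[lebesgue_measure]_(s in `[a, b]) ((f s w) ^+ 2)%:E)%E.
Proof.
apply: (measurable_time_integral (u := fun x => x ^+ 2)).
- exact: exprn_measurable.
- by rewrite expr0n.
- by move=> x; exact: sqr_ge0.
Qed.

Let sqr_lin_le (K x y k : R) : `|k| <= K ->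
  (k * x + y) ^+ 2 <= (2 * K ^+ 2) * x ^+ 2 + 2 * y ^+ 2.
Proof.
move=> kK; have : k ^+ 2 <= K ^+ 2.
  by rewrite -[k ^+ 2]real_normK ?num_real// lerXn2r ?nnegrE// (le_trans _ kK).
have := sqr_ge0 x; have := sqr_ge0 (k * x - y); nra.
Qed.

Lemma sqr_integral_lin (c x y : Om -> R) (K : R) :
  measurable_fun setT c -> (forall w, `|c w| <= K) ->
  measurable_fun setT x -> measurable_fun setT y ->
  (\int[P]_w ((c w * x w + y w) ^+ 2)%:E <=
   (2 * K ^+ 2)%:E * (\int[P]_w ((x w) ^+ 2)%:E) +
     2%:E * (\int[P]_w ((y w) ^+ 2)%:E))%E.
Proof.
move=> mc cK mx my; apply: le_ge0_integral_lin => //.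
- by rewrite mulr_ge0// sqr_ge0.
- by move=> w _; rewrite lee_fin sqr_ge0.
- apply/measurable_EFinP/measurable_funX/measurable_funD => //.
  exact: measurable_funM.
- by move=> w _; rewrite lee_fin sqr_ge0.
- by apply/measurable_EFinP; exact: measurable_funX.
- by move=> w _; rewrite lee_fin sqr_ge0.
- by apply/measurable_EFinP; exact: measurable_funX.
- by move=> w _; rewrite -!EFinM -EFinD lee_fin; exact: sqr_lin_le.
Qed.

(** The convexity bound [(k x + y)^2 <= 2 k^2 x^2 + 2 y^2], integrated over time
    and over the sample space. *)
Lemma energy_lin c f g (K : R) :
  measurable_fun setT c -> (forall w, `|c w| <= K) ->
  jointly_measurable f -> jointly_measurable g ->
  (energy P a b (fun s w => c w * f s w + g s w)%R <=
   (2 * K ^+ 2)%:E * energy P a b f + 2%:E * energy P a b g)%E.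
Proof.
move=> mc cK mf mg; rewrite /energy.
have E0 h w : (0 <= \int[lebesgue_measure]_(s in `[a, b]) ((h s w) ^+ 2)%:E)%E.
  by apply: integral_ge0 => s _; rewrite lee_fin sqr_ge0.
have mh h w : jointly_measurable h ->
    measurable_fun `[a, b] (fun s => ((h s w) ^+ 2)%:E).
  move=> /(jointly_measurable_path w) mh; apply/measurable_EFinP.
  exact: measurable_funX.
have mlin := jointly_measurable_lin mc mf mg.
have K0 : 0 <= 2 * K ^+ 2 by rewrite mulr_ge0// sqr_ge0.
apply: le_ge0_integral_lin => //.
- by move=> w _; exact: (E0 (fun s w => c w * f s w + g s w)).
- exact: (measurable_path_energy mlin).
- exact: measurable_path_energy.
- exact: measurable_path_energy.
move=> w _; apply: le_ge0_integral_lin => //;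
  [|exact: (mh _ w mlin)| |exact: mh| |exact: mh|].
- by move=> s _; rewrite lee_fin sqr_ge0.
- by move=> s _; rewrite lee_fin sqr_ge0.
- by move=> s _; rewrite lee_fin sqr_ge0.
- by move=> s _; rewrite -!EFinM -EFinD lee_fin; exact: sqr_lin_le.
Qed.

Let sqr_prod_le (K k x y : R) : `|k| <= K ->
  `|k * x * y| <= K * x ^+ 2 + K * y ^+ 2.
Proof.
move=> kK; have K0 : 0 <= K by apply: le_trans kK.
rewrite -mulrA normrM -mulrDr; apply: ler_pM => //.
have xy := sqr_ge0 (x - y); have xy' := sqr_ge0 (x + y).
by rewrite ler_norml; apply/andP; split; nra.
Qed.

Definition essentially_bounded f : Prop :=
  exists K, {ae P, forall w s, a <= s <= b -> `|f s w| <= K}.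

Definition L1_process h : Prop :=
  jointly_measurable h /\
  (\int[P]_w \int[lebesgue_measure]_(s in `[a, b]) `|h s w|%:E < +oo)%E.

Definition L2_process f : Prop :=
  jointly_measurable f /\ (energy P a b f < +oo)%E.

Let measurable_path_norm h : jointly_measurable h -> measurable_fun setT
  (fun w => \int[lebesgue_measure]_(s in `[a, b]) `|h s w|%:E)%E.
Proof. by move=> mh; apply: measurable_time_integral => //; rewrite normr0. Qed.

Lemma L1_process_lin c f g (K : R) :
  measurable_fun setT c -> (forall w, `|c w| <= K) ->
  L1_process f -> L1_process g -> L1_process (fun s w => c w * f s w + g s w).
Proof.
move=> mc cK [mf f1] [mg g1]; have mfg := jointly_measurable_lin mc mf mg.
split; first exact: mfg.
have mn h w : jointly_measurable h ->
    measurable_fun `[a, b] (fun s => `|h s w|%:E).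
  move=> /(jointly_measurable_path w) mh.
  exact/measurable_EFinP/measurableT_comp.
have [K' [K'0 cK']] : exists K', 0 <= K' /\ forall w, `|c w| <= K'.
  by exists `|K|; split => // w; exact: le_trans (cK w) (ler_norm _).
pose N h := (\int[P]_w \int[lebesgue_measure]_(s in `[a, b]) `|h s w|%:E)%E.
apply: (@le_lt_trans _ _ (K'%:E * N f + 1%:E * N g)%E); last first.
  by apply: lte_add_pinfty; apply: lte_mul_pinfty.
have n0 h w : (0 <= \int[lebesgue_measure]_(s in `[a, b]) `|h s w|%:E)%E.
  by apply: integral_ge0 => s _; rewrite lee_fin.
apply: le_ge0_integral_lin => //.
- by move=> w _; exact: (n0 (fun s w => c w * f s w + g s w)).
- exact: (measurable_path_norm mfg).
- exact: measurable_path_norm.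
- exact: measurable_path_norm.
move=> w _; apply: le_ge0_integral_lin => //.
- exact: (mn _ w mfg).
- exact: mn.
- exact: mn.
- move=> s _; rewrite -!EFinM -EFinD lee_fin (le_trans (ler_normD _ _))//.
  by rewrite mul1r lerD2r normrM ler_wpM2r.
Qed.

Lemma L1_process0 : L1_process (fun _ _ => 0).
Proof.
split; first exact: measurable_cst.
by rewrite integral0_eq// => w _; rewrite integral0_eq// => s _; rewrite normr0.
Qed.

Lemma L1_process_sum (I : Type) (r : seq I) (F : I -> R -> Om -> R) :
  (forall i, L1_process (F i)) -> L1_process (fun s w => \sum_(i <- r) F i s w).
Proof.
move=> F1; elim: r => [|i r IH].
  rewrite (_ : (fun _ _ => _) = fun _ _ => 0); first exact: L1_process0.
  by apply/funext => s; apply/funext => w; rewrite big_nil.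
rewrite (_ : (fun _ _ => _) = fun s w => 1 * F i s w + \sum_(j <- r) F j s w).
  by apply: (@L1_process_lin (fun _ => 1) _ _ 1) => // w; rewrite normr1.
by apply/funext => s; apply/funext => w; rewrite big_cons mul1r.
Qed.

(** By [|f g| <= f^2 + g^2], a bounded coefficient times two square-integrable
    processes is integrable.  The terms of the cost are of this kind, and so
    are those of the drift, with a constant third factor. *)
Lemma L1_process_triple k f g : jointly_measurable k -> essentially_bounded k ->
  L2_process f -> L2_process g ->
  L1_process (fun s w => k s w * f s w * g s w).
Proof.
move=> mk [K bK] [mf ef] [mg eg].
have mh : jointly_measurable (fun s w => k s w * f s w * g s w).
  by apply: jointly_measurableM => //; exact: jointly_measurableM.
split; first exact: mh.
have [K' [K'0 KK']] : exists K', 0 <= K' /\ K <= K'.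
  by exists `|K|; rewrite ler_norm.
apply: (@le_lt_trans _ _
    (K'%:E * energy P a b f + K'%:E * energy P a b g)%E); last first.
  by apply: lte_add_pinfty; apply: lte_mul_pinfty; rewrite ?lee_fin.
have E0 h w : (0 <= \int[lebesgue_measure]_(s in `[a, b]) ((h s w) ^+ 2)%:E)%E.
  by apply: integral_ge0 => s _; rewrite lee_fin sqr_ge0.
have mE : measurable_fun setT (fun w =>
    (K'%:E * (\int[lebesgue_measure]_(s in `[a, b]) ((f s w) ^+ 2)%:E) +
    K'%:E * (\int[lebesgue_measure]_(s in `[a, b]) ((g s w) ^+ 2)%:E))%E).
  by apply: emeasurable_funD; apply: measurable_funeM;
    exact: measurable_path_energy.
apply: (@le_trans _ _ (\int[P]_w
    (K'%:E * (\int[lebesgue_measure]_(s in `[a, b]) ((f s w) ^+ 2)%:E) +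
    K'%:E * (\int[lebesgue_measure]_(s in `[a, b]) ((g s w) ^+ 2)%:E)))%E).
- apply: ae_ge0_le_integral => //.
  + by move=> w _; apply: integral_ge0 => s _; rewrite lee_fin.
  + exact: (measurable_path_norm mh).
  + by move=> w _; rewrite adde_ge0// mule_ge0 ?lee_fin.
  + apply: filterS bK => w Kw _.
    apply: le_ge0_integral_lin => //.
    * apply/measurable_EFinP/measurableT_comp => //.
      exact: jointly_measurable_path mh.
    * by move=> s _; rewrite lee_fin sqr_ge0.
    * by apply/measurable_EFinP/measurable_funX; exact: jointly_measurable_path.
    * by move=> s _; rewrite lee_fin sqr_ge0.
    * by apply/measurable_EFinP/measurable_funX; exact: jointly_measurable_path.
    * move=> s /=; rewrite in_itv/= => sab; rewrite -!EFinM -EFinD lee_fin.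
      by apply: sqr_prod_le; apply: le_trans KK'; exact: Kw.
- apply: le_ge0_integral_lin => //.
  + by move=> w _; rewrite adde_ge0// mule_ge0 ?lee_fin.
  + exact: measurable_path_energy.
  + exact: measurable_path_energy.
Qed.

(** The analogue of [L1_process_triple] at a fixed time, for terminal costs. *)
Lemma rv_triple_integrable (k x y : Om -> R) :
  measurable_fun setT k -> rv_bounded P k ->
  measurable_fun setT x -> rv_sqint P x ->
  measurable_fun setT y -> rv_sqint P y ->
  P.-integrable setT (fun w => (k w * x w * y w)%:E).
Proof.
move=> mk [K bK] mx ex my ey.
have mh : measurable_fun setT (fun w => k w * x w * y w).
  by apply: measurable_funM => //; exact: measurable_funM.
apply/integrableP; split; first exact/measurable_EFinP.
have [K' [K'0 KK']] : exists K', 0 <= K' /\ K <= K'.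
  by exists `|K|; rewrite ler_norm.
have msq (f : Om -> R) : measurable_fun setT f ->
    measurable_fun setT (fun w => ((f w) ^+ 2)%:E).
  by move=> mf; apply/measurable_EFinP; exact: measurable_funX.
have mE : measurable_fun setT
    (fun w => (K'%:E * ((x w) ^+ 2)%:E + K'%:E * ((y w) ^+ 2)%:E)%E).
  by apply: emeasurable_funD; apply: measurable_funeM; exact: msq.
apply: (@le_lt_trans _ _ (K'%:E * (\int[P]_w ((x w) ^+ 2)%:E) +
    K'%:E * (\int[P]_w ((y w) ^+ 2)%:E))%E); last first.
  by apply: lte_add_pinfty; apply: lte_mul_pinfty; rewrite ?lee_fin.
apply: (@le_trans _ _ (\int[P]_w
    (K'%:E * ((x w) ^+ 2)%:E + K'%:E * ((y w) ^+ 2)%:E))%E).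
- apply: ae_ge0_le_integral => //.
  + exact/measurable_EFinP/measurableT_comp.
  + by move=> w _; rewrite adde_ge0// mule_ge0 ?lee_fin ?sqr_ge0.
  + apply: filterS bK => w Kw _; rewrite -!EFinM -EFinD lee_fin.
    by apply: sqr_prod_le; exact: le_trans KK'.
- apply: le_ge0_integral_lin => //.
  + by move=> w _; rewrite adde_ge0// mule_ge0 ?lee_fin ?sqr_ge0.
  + by move=> w _; rewrite lee_fin sqr_ge0.
  + exact: msq.
  + by move=> w _; rewrite lee_fin sqr_ge0.
  + exact: msq.
Qed.

Section TimeIntegral.
Variable h : R -> Om -> R.
Hypothesis h1 : L1_process h.

Let h_integrable :
  (P \x lebesgue_measure)%E.-integrable setT (fun z => (restr h z)%:E).
Proof.
have [mh hy] := h1.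
apply/integrable12ltyP.
  by apply/measurable_EFinP; exact: measurable_restr.
under eq_integral do
  rewrite /= -(integral_restr (u := @Num.norm R R)) ?normr0//.
exact: hy.
Qed.

Lemma L1_process_path_integrable :
  {ae P, forall w,
    lebesgue_measure.-integrable `[a, b] (fun s => (h s w)%:E)}.
Proof.
have := ae_integrable1 h_integrable; apply: filterS => w iw.
apply/integrable_mkcond => //; apply: eq_integrable iw => // s _.
by rewrite /restr /= indicE /patch; case: ifP => _; rewrite ?mul1r ?mul0r.
Qed.

Lemma L1_process_integrable :
  P.-integrable setT
    (fun w => (\int[lebesgue_measure]_(s in `[a, b]) (h s w))%:E).
Proof.
have iF := integrable_fubini_F h_integrable.
have mF := measurable_int _ iF.
rewrite (_ : (fun w => _) =
  fun w => (fine (fubini_F lebesgue_measure (fun z => (restr h z)%:E) w))%:E).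
  apply: le_integrable iF => //.
    apply/measurable_EFinP; apply: measurableT_comp mF.
    exact: fine_measurable.
  move=> w _; case: (fubini_F _ _ w) => [r| |] //=; by rewrite normr0 leey.
by apply/funext => w; rewrite /fubini_F /Rintegral -(integral_restr (u := id)).
Qed.

End TimeIntegral.

End JointMeasurability.

(** * Random linear combinations of Ito integrals *)

Definition filtration_on (R : realType) (d : measure_display)
    (Om : measurableType d) (Fl : R -> set (set Om)) (a b : R) : Prop :=
  [/\ forall s, a <= s <= b -> sigma_algebra setT (Fl s),
      forall s, a <= s <= b -> Fl s `<=` measurable &
      forall r s, a <= r -> r <= s -> s <= b -> Fl r `<=` Fl s].

Lemma generated_filtration (R : realType) (d : measure_display)
    (Om : measurableType d) (E : R -> set (set Om)) (a b : R) :
  (forall s, a <= s <= b -> E s `<=` measurable) ->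
  (forall r s, r <= s -> E r `<=` E s) ->
  filtration_on (fun s => <<s E s >>) a b.
Proof.
move=> mE nE; split.
- by move=> s _; exact: smallest_sigma_algebra.
- move=> s sab; apply: smallest_sub; first exact: sigma_algebra_measurable.
  exact: mE.
- by move=> r s _ rs _; apply: sub_sigma_algebra2; exact: nE.
Qed.

Section Filtration.
Context {R : realType} {d : measure_display} {Om : measurableType d}.
Variable P : probability Om R.
Variables (Fl : R -> set (set Om)) (a b : R).
Hypothesis ab : a <= b.
Hypothesis Fl_filtration : filtration_on Fl a b.
Implicit Types (f g h : R -> Om -> R) (c : Om -> R).

Let Fl_sigma s : a <= s <= b -> sigma_algebra setT (Fl s).
Proof. by have [+ _ _] := Fl_filtration; exact. Qed.

Let Fl_meas s : a <= s <= b -> Fl s `<=` measurable.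
Proof. by have [_ + _] := Fl_filtration; exact. Qed.

Let a_in : a <= a <= b. Proof. by rewrite lexx. Qed.
Let b_in : a <= b <= b. Proof. by rewrite ab lexx. Qed.

Lemma adapted_measurable s c : a <= s <= b -> rv_measurable (Fl s) c ->
  measurable_fun setT c.
Proof.
by move=> sab; apply: rv_measurable_fun; [exact: Fl_sigma|exact: Fl_meas].
Qed.

Lemma rv_measurable_mono r s c : a <= r -> r <= s -> s <= b ->
  rv_measurable (Fl r) c -> rv_measurable (Fl s) c.
Proof.
move=> ar rs sb mc _ U mU.
have Gs := Fl_sigma (s := s); have Gr := Fl_sigma (s := r).
have [_ _ mono] := Fl_filtration.
apply/(sub_eventP (Gs _)); first by rewrite (le_trans ar rs).
apply: (mono r s) => //; apply/(sub_eventP (Gr _)).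
  by rewrite ar (le_trans rs sb).
exact: mc.
Qed.

Lemma progressive_jointly_measurable f :
  progressive Fl a b f -> jointly_measurable a b f.
Proof.
move=> /(_ b b_in) pf.
apply: (@measurable_comp _ _ _
  (R * Om)%type (R * g_sigma_algebraType (Fl b))%type R
  (`[a, b] `*` [set: g_sigma_algebraType (Fl b)])
  (fun z => f z.1 z.2) (`[a, b] `*` [set: Om])
  (fun z => (z.1, z.2)) _ _ pf).
- apply: measurableX => //.
- by move=> _ [z [zab _] <-].
- apply: measurable_funTS; apply: measurable_fun_pair => //.
  exact: (measurableT_comp (measurable_to_sub (Fl_sigma b_in) (Fl_meas b_in))
    (@measurable_snd _ _ _ _)).
Qed.

(** A variable known at the initial time is a progressive process, constant in
    time, by monotonicity of the filtration. *)
Lemma progressive_lin c f g : rv_measurable (Fl a) c ->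
  progressive Fl a b f -> progressive Fl a b g ->
  progressive Fl a b (fun s w => c w * f s w + g s w).
Proof.
move=> mc pf pg s sab; have [as_ sb] := andP sab.
apply: measurable_funD; last exact: pg.
apply: measurable_funM; last exact: pf.
apply: measurable_funTS.
apply: (measurableT_comp _
  (@measurable_snd _ _ _ (g_sigma_algebraType (Fl s)))).
exact: (rv_measurable_mono (lexx a) as_ sb mc).
Qed.

Lemma L2F_lin c f g (K : R) :
  rv_measurable (Fl a) c -> (forall w, `|c w| <= K) ->
  L2F P Fl a b f -> L2F P Fl a b g ->
  L2F P Fl a b (fun s w => c w * f s w + g s w).
Proof.
move=> mc cK [pf ef] [pg eg]; split; first exact: progressive_lin.
have mc' := adapted_measurable a_in mc.
have jf := progressive_jointly_measurable pf.
have jg := progressive_jointly_measurable pg.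
apply: le_lt_trans (energy_lin P mc' cK jf jg) _.
have K0 : 0 <= 2 * K ^+ 2 by rewrite mulr_ge0// sqr_ge0.
by rewrite lte_add_pinfty// lte_mul_pinfty.
Qed.

(** Multiplying a step by a variable known at time [a] keeps its height
    measurable at the time [lo] where the step starts, because [a <= lo]. *)
Definition scale_step c (st : step) : step :=
  Step (lo st) (hi st) (fun w => c w * height st w).

Lemma scale_step_ok c (K : R) (st : step) :
  rv_measurable (Fl a) c -> (forall w, `|c w| <= K) ->
  step_ok P Fl a b st -> step_ok P Fl a b (scale_step c st).
Proof.
move=> mc cK [alo lohi hib mh [M bM]]; split => //=.
  apply: measurable_funM => //.
  exact: (rv_measurable_mono (lexx a) alo (le_trans lohi hib) mc).
exists (K * M); apply: filterS bM => w wM.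
by rewrite normrM; apply: ler_pM.
Qed.

Lemma simple_val_lin c (cs ds : seq step) s w :
  simple_val (map (scale_step c) cs ++ ds) s w =
  c w * simple_val cs s w + simple_val ds s w.
Proof.
rewrite /simple_val big_cat/= big_map big_distrr/=; congr (_ + _).
by apply: eq_bigr => st _; rewrite mulrA.
Qed.

Lemma simple_int_lin (W : R -> Om -> R) c (cs ds : seq step) s w :
  simple_int W (map (scale_step c) cs ++ ds) s w =
  c w * simple_int W cs s w + simple_int W ds s w.
Proof.
rewrite /simple_int big_cat/= big_map big_distrr/=; congr (_ + _).
by apply: eq_bigr => st _; rewrite mulrA.
Qed.

Lemma simple_val_jointly_measurable (cs : seq step) :
  List.Forall (step_ok P Fl a b) cs -> jointly_measurable a b (simple_val cs).
Proof.
elim=> [|st ds [alo lohi hib mh bh] _ IH].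
  rewrite (_ : simple_val [::] = fun _ _ => 0) //; first exact: measurable_cst.
  by apply/funext => s; apply/funext => w; rewrite /simple_val big_nil.
rewrite (_ : simple_val _ = fun s w =>
    height st w * (lo st < s <= hi st)%R%:R + simple_val ds s w); last first.
  by apply/funext => s; apply/funext => w; rewrite /simple_val big_cons.
apply: jointly_measurableD => //; apply: jointly_measurableM.
  apply: jointly_measurable_rv; apply: adapted_measurable mh.
  by rewrite alo (le_trans lohi hib).
apply: measurable_funTS.
rewrite (_ : (fun z => _) = \1_(`]lo st, hi st]%classic) \o fst); last first.
  by apply/funext => -[s w] /=; rewrite indicE mem_setE in_itv.
apply: measurableT_comp => //.
Qed.

Lemma simple_int_measurable (W : R -> Om -> R) (cs : seq step) s :
  (forall r, a <= r <= b -> measurable_fun setT (W r)) -> a <= s <= b ->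
  List.Forall (step_ok P Fl a b) cs -> measurable_fun setT (simple_int W cs s).
Proof.
move=> mW /andP[as_ sb]; elim=> [|st ds [alo lohi hib mh bh] _ IH].
  rewrite (_ : simple_int W [::] s = fun _ => 0) //.
  by apply/funext => w; rewrite /simple_int big_nil.
rewrite (_ : simple_int _ _ _ = fun w =>
    height st w * (W (Num.min (hi st) s) w - W (Num.min (lo st) s) w)
    + simple_int W ds s w); last first.
  by apply/funext => w; rewrite /simple_int big_cons.
apply: measurable_funD => //; apply: measurable_funM.
  by apply: adapted_measurable mh; rewrite alo (le_trans lohi hib).
by apply: measurable_funB; apply: mW;
  rewrite le_min ge_min as_ sb orbT ?andbT// (le_trans alo lohi).
Qed.

Let cvg0_lin (x y z : nat -> \bar R) (K : R) : 0 <= K ->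
  (forall n, 0 <= z n <= K%:E * x n + 2%:E * y n)%E ->
  (x n @[n --> \oo] --> 0)%E -> (y n @[n --> \oo] --> 0)%E ->
  (z n @[n --> \oo] --> 0)%E.
Proof.
move=> K0 zxy x0 y0.
apply: (@squeeze_cvge _ _ _ _ (cst 0%E) _ (fun n => K%:E * x n + 2%:E * y n)%E).
- exact: nearW.
- exact: cvg_cst.
- rewrite -[X in _ --> X](_ : K%:E * 0 + 2%:E * 0 = 0)%E; last first.
    by rewrite !mule0 adde0.
  apply: cvgeD; first by rewrite !mule0.
  + exact: cvgeZl.
  + exact: cvgeZl.
Qed.

(** Scaled steps of approximants of [f], concatenated with steps of approximants
    of [g], approximate [c f + g]; the bound of [energy_lin] and its analogue
    at a fixed time give both convergences. *)
Lemma ito_lin (W : R -> Om -> R) c (K : R) f g I J :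
  (forall r, a <= r <= b -> measurable_fun setT (W r)) ->
  rv_measurable (Fl a) c -> (forall w, `|c w| <= K) ->
  is_ito P Fl W a b f I -> is_ito P Fl W a b g J ->
  is_ito P Fl W a b (fun s w => c w * f s w + g s w)
                    (fun s w => c w * I s w + J s w).
Proof.
move=> mW mc cK.
move=> [L2f aI cI [cs [cs_ok cs_f cs_I]]] [L2g aJ cJ [ds [ds_ok ds_g ds_J]]].
have mc' := adapted_measurable a_in mc.
have K0 : 0 <= 2 * K ^+ 2 by rewrite mulr_ge0// sqr_ge0.
split; first exact: L2F_lin.
- move=> s sab; have [as_ sb] := andP sab.
  apply: measurable_funD; last exact: aJ.
  apply: measurable_funM; last exact: aI.
  exact: (rv_measurable_mono (lexx a) as_ sb mc).
- apply: filterS2 cI cJ => w cI cJ s.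
  by apply: cvgD; [apply: cvgM; [exact: cvg_cst|exact: cI]|exact: cJ].
exists (fun k => map (scale_step c) (cs k) ++ ds k).
have jsub h (es : seq step) :
    L2F P Fl a b h -> List.Forall (step_ok P Fl a b) es ->
    jointly_measurable a b (fun s w => h s w - simple_val es s w).
  move=> [ph _] es_ok; apply: measurable_funB.
    exact: progressive_jointly_measurable.
  exact: simple_val_jointly_measurable.
have msub s h (es : seq step) : a <= s <= b -> rv_measurable (Fl s) (h s) ->
    List.Forall (step_ok P Fl a b) es ->
    measurable_fun setT (fun w => h s w - simple_int W es s w).
  move=> sab mh es_ok; apply: measurable_funB.
    exact: adapted_measurable mh.
  exact: simple_int_measurable.
split.
- move=> k; apply/List.Forall_app; split => //.
  apply/List.Forall_map; apply: List.Forall_impl (cs_ok k) => st.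
  exact: scale_step_ok cK.
- apply: (cvg0_lin K0 _ cs_f ds_g) => k; apply/andP; split.
    apply: integral_ge0 => w _; apply: integral_ge0 => s _.
    by rewrite lee_fin sqr_ge0.
  have := energy_lin P mc' cK (jsub _ _ L2f (cs_ok k)) (jsub _ _ L2g (ds_ok k)).
  apply: le_trans; rewrite le_eqVlt; apply/orP; left; apply/eqP.
  congr energy; apply/funext => s; apply/funext => w.
  by rewrite simple_val_lin; ring.
- move=> s sab; apply: (cvg0_lin K0 _ (cs_I s sab) (ds_J s sab)) => k.
  apply/andP; split.
    by apply: integral_ge0 => w _; rewrite lee_fin sqr_ge0.
  have := sqr_integral_lin P mc' cK
    (msub _ _ _ sab (aI s sab) (cs_ok k)) (msub _ _ _ sab (aJ s sab) (ds_ok k)).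
  apply: le_trans; rewrite le_eqVlt; apply/orP; left; apply/eqP.
  apply: eq_integral => w _; congr (_ ^+ 2)%:E.
  by rewrite simple_int_lin; ring.
Qed.

End Filtration.

(** * Linearity of the state equation and bilinearity of the cost *)

Lemma dotpDl (R : realType) n (x x' y : 'cV[R]_n) c :
  dotp (c *: x + x') y = c * dotp x y + dotp x' y.
Proof.
rewrite /dotp big_distrr -big_split/=; apply: eq_bigr => i _.
by rewrite !mxE mulrDl mulrA.
Qed.

Lemma dotpC (R : realType) n (x y : 'cV[R]_n) : dotp x y = dotp y x.
Proof. by rewrite /dotp; apply: eq_bigr => i _; rewrite mulrC. Qed.

Lemma dotp_mulmx (R : realType) p q (M : 'M[R]_(p, q)) x y :
  dotp (M *m x) y = \sum_i \sum_j M i j * x j 0 * y i 0.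
Proof. by rewrite /dotp; apply: eq_bigr => i _; rewrite mxE big_distrl. Qed.

Lemma dotp_delta (R : realType) n (x : 'cV[R]_n) i :
  dotp x (delta_mx i 0) = x i 0.
Proof.
rewrite /dotp (bigD1 i)//= mxE !eqxx mulr1 big1 ?addr0// => j ji.
by rewrite mxE (negbTE ji) mulr0.
Qed.

(** A parabola through the origin that is nonnegative at points on both sides of
    the origin and arbitrarily close to it has no linear term, and hence a
    nonnegative quadratic one.  Countably many points are used so
    that almost sure inequalities, one for each point, hold simultaneously. *)
Lemma linear_term0 (R : realType) (x y : R) :
  (forall i : nat, 0 <= i.+1%:R^-1 ^+ 2 * y + i.+1%:R^-1 * x) ->
  (forall i : nat, 0 <= i.+1%:R^-1 ^+ 2 * y - i.+1%:R^-1 * x) ->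
  x = 0 /\ 0 <= y.
Proof.
move=> h1 h2.
have xy i : i.+1%:R * `|x| <= y.
  have i0 : 0 < i.+1%:R :> R by [].
  have := h2 i; have := h1 i.
  rewrite expr2 -!mulrA -!mulrDr -mulrBr !pmulr_rge0 ?invr_gt0// => h4 h3.
  rewrite mulrC -ler_pdivlMr// ler_norml mulrC; set v := _^-1 * y in h3 h4 *.
  by apply/andP; split; lra.
have y0 : 0 <= y by apply: le_trans (xy 0%N); rewrite mulr_ge0.
split => //; apply/eqP; rewrite -normr_le0 leNgt; apply/negP => x0.
have := archi_boundP (divr_ge0 y0 (ltW x0)); rewrite ltr_pdivrMr// => yx.
have := le_lt_trans (xy (Num.bound (y / `|x|))) yx.
by rewrite ltr_pM2r// ltr_nat ltnNge leqnSn.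
Qed.

Section LinearQuadratic.
Context {R : realType} {d : measure_display} {Om : measurableType d}.
Variables (P : probability Om R) (T : R) (n m L : nat).
Variables (W : R -> Om -> R) (alpha : R -> Om -> 'I_L).
Variable al : R -> (Om -> 'I_L) -> R -> Om -> 'I_L.
Variable k : @coefficients R d Om n m L.
Hypothesis P_complete : measure_is_complete P.
Hypothesis W_meas : forall s, 0 <= s <= T -> measurable_fun setT (W s).
Hypothesis alpha_meas :
  forall s l, 0 <= s <= T -> measurable (alpha s @^-1` [set l]).
Hypothesis k_ok : admissible_coefficients P T (filtW P W) k.
Variables (t : R) (theta : Om -> 'I_L).
Hypothesis t_range : 0 <= t <= T.
Hypothesis regime_progressive : forall l,
  progressive (filtA P alpha) t T (fun s w => (al t theta s w == l)%:R).

Local Notation F := (filtWA P W alpha).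
Local Notation beta := (al t theta).

Let real_events_meas s : 0 <= s <= T -> real_events W s `<=` measurable.
Proof.
move=> /andP[s0 sT] _ [r [U [/andP[r0 rs] mU ->]]].
rewrite -[X in measurable X]setTI; apply: W_meas => //.
by rewrite r0 (le_trans rs sT).
Qed.

Let state_events_meas s : 0 <= s <= T -> state_events alpha s `<=` measurable.
Proof.
move=> /andP[s0 sT] _ [r [l [/andP[r0 rs] ->]]].
by apply: alpha_meas; rewrite r0 (le_trans rs sT).
Qed.

Let real_events_mono r s : r <= s -> real_events W r `<=` real_events W s.
Proof.
move=> rs _ [v [U [/andP[v0 vr] mU ->]]]; exists v, U; split => //.
by rewrite v0 (le_trans vr rs).
Qed.

Let state_events_mono r s : r <= s ->
  state_events alpha r `<=` state_events alpha s.
Proof.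
move=> rs _ [v [l [/andP[v0 vr] ->]]]; exists v, l; split => //.
by rewrite v0 (le_trans vr rs).
Qed.

Lemma filtW_filtration : filtration_on (filtW P W) 0 T.
Proof.
apply: generated_filtration => [s s0T|r s rs].
  by rewrite subUset; split; [exact: real_events_meas|exact: P_complete].
by apply: setSU; exact: real_events_mono.
Qed.

Lemma filtA_filtration : filtration_on (filtA P alpha) t T.
Proof.
have [t0 tT] := andP t_range.
apply: generated_filtration => [s /andP[ts sT]|r s rs].
  rewrite subUset; split; last exact: P_complete.
  by apply: state_events_meas; rewrite (le_trans t0 ts).
by apply: setSU; exact: state_events_mono.
Qed.

Lemma filtWA_filtration : filtration_on F t T.
Proof.
have [t0 tT] := andP t_range.
apply: generated_filtration => [s /andP[ts sT]|r s rs].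
  have s0T : 0 <= s <= T by rewrite (le_trans t0 ts).
  rewrite !subUset; split; last exact: P_complete.
  by split; [exact: real_events_meas|exact: state_events_meas].
by apply: setSU; apply: setUSS;
  [exact: real_events_mono|exact: state_events_mono].
Qed.

Let tT : t <= T. Proof. by case/andP: t_range. Qed.
Let t_in : t <= t <= T. Proof. by rewrite lexx. Qed.
Let T_in : t <= T <= T. Proof. by rewrite tT lexx. Qed.
Let F_sigma : sigma_algebra setT (F t).
Proof. by case: filtWA_filtration => + _ _; exact. Qed.
Let F_meas : F t `<=` measurable.
Proof. by case: filtWA_filtration => _ + _; exact. Qed.

Local Notation jm := (jointly_measurable t T).

Lemma regime_jointly_measurable l : jm (fun s w => (beta s w == l)%:R).
Proof. exact: (progressive_jointly_measurable tT filtA_filtration). Qed.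

(** A coefficient evaluated along the regime is the sum over the regimes [j] of
    the indicator of [j] times the coefficient frozen at [j].  Measurability
    thus follows from that of the chain and of the frozen coefficients. *)
Let regime_sum (v : 'I_L -> R) (l : 'I_L) : v l = \sum_j (l == j)%:R * v j.
Proof.
rewrite (bigD1 l)//= eqxx mul1r big1 ?addr0// => j jl.
by rewrite eq_sym (negbTE jl) mul0r.
Qed.

Definition regime_coefficient p q (f : R -> 'I_L -> Om -> 'M[R]_(p, q)) :
    Prop :=
  forall l, progressive_mx (filtW P W) 0 T (f ^~ l) /\
            bounded_process_mx P 0 T (f ^~ l).

Lemma regime_coefficient_jm p q f i j : @regime_coefficient p q f ->
  jm (fun s w => f s (beta s w) w i j).
Proof.
move=> fok.
rewrite (_ : (fun s w => _) =
    fun s w => \sum_l (beta s w == l)%:R * f s l w i j); last first.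
  by apply/funext => s; apply/funext => w; rewrite -regime_sum.
apply: jointly_measurable_sum => l; apply: jointly_measurableM.
  exact: regime_jointly_measurable.
have [t0 _] := andP t_range.
have [/(_ i j) pf _] := fok l.
have := progressive_jointly_measurable (le_trans t0 tT) filtW_filtration pf.
apply: measurable_funS; first exact: measurableX.
move=> [s w] [/= + _]; rewrite in_itv/= => /andP[ts sT]; split => //=.
by rewrite in_itv/= sT (le_trans t0 ts).
Qed.

Lemma regime_coefficient_bounded p q f i j : @regime_coefficient p q f ->
  essentially_bounded P t T (fun s w => f s (beta s w) w i j).
Proof.
move=> fok; have [t0 _] := andP t_range.
have /choice[K bK] l := (fok l).2.
exists (\sum_l `|K l|).
have := filter_forall (ae_filter_ringOfSetsType P) bK.
apply: filterS => w bw s /andP[ts sT].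
apply: le_trans (bw (beta s w) s _ i j) _; first by rewrite (le_trans t0 ts).
by rewrite (bigD1 (beta s w))//= (le_trans (ler_norm _))// lerDl sumr_ge0.
Qed.

Definition L2_process_mx p q (f : R -> Om -> 'M[R]_(p, q)) : Prop :=
  forall i j, L2_process P t T (fun s w => f s w i j).

Lemma L2F_mx_process p q (f : R -> Om -> 'M[R]_(p, q)) :
  L2F_mx P F t T f -> L2_process_mx f.
Proof.
move=> L2f i j; have [pf ef] := L2f i j; split => //.
exact: (progressive_jointly_measurable tT filtWA_filtration).
Qed.

Lemma L2_process_cst p q (M : 'M[R]_(p, q)) : L2_process_mx (fun _ _ => M).
Proof.
move=> i j; split; first exact: measurable_cst.
rewrite /energy; under eq_integral do rewrite integral_cst//=.
rewrite integral_cst//= probability_setT mule1 lebesgue_measure_itv/=.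
by case: ifP => _; rewrite ?mule0 ?ltry// -EFinB -EFinM ltry.
Qed.

Lemma form_L1 p q M (x : R -> Om -> 'cV[R]_q) (y : R -> Om -> 'cV[R]_p) :
  @regime_coefficient p q M -> L2_process_mx x -> L2_process_mx y ->
  L1_process P t T (fun s w => dotp (M s (beta s w) w *m x s w) (y s w)).
Proof.
move=> Mok x2 y2.
under eq_fun do under eq_fun do rewrite dotp_mulmx.
apply: L1_process_sum => i; apply: L1_process_sum => j.
apply: L1_process_triple => //.
- exact: regime_coefficient_jm.
- exact: regime_coefficient_bounded.
Qed.

(** A coordinate of [M x] is the form of [M] at [x] and a basis vector, a
    constant process. *)
Lemma mulmx_path_integrable p q M (x : R -> Om -> 'cV[R]_q) :
  @regime_coefficient p q M -> L2_process_mx x ->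
  {ae P, forall w, forall i, lebesgue_measure.-integrable `[t, T]
    (fun s => ((M s (beta s w) w *m x s w) i 0)%:E)}.
Proof.
move=> Mok x2; apply: filter_forall => i.
have := L1_process_path_integrable
  (form_L1 Mok x2 (L2_process_cst (delta_mx i 0))).
apply: filterS => w; apply: eq_integrable => // s _.
by rewrite dotp_delta.
Qed.

Definition trajectory : Type :=
  ((R -> Om -> 'cV[R]_m) * (R -> Om -> 'cV[R]_n))%type.

Definition combine (c : Om -> R) (z z' : trajectory) : trajectory :=
  (fun s w => c w *: z.1 s w + z'.1 s w, fun s w => c w *: z.2 s w + z'.2 s w).

Definition admissible (xi : Om -> 'cV[R]_n) (z : trajectory) : Prop :=
  control P T W alpha t z.1 /\ is_state P T W alpha al k t xi theta z.1 z.2.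

Let cA_ok : regime_coefficient (cA k).
Proof. by move=> l; have [[]] := k_ok l. Qed.
Let cB_ok : regime_coefficient (cB k).
Proof. by move=> l; have [[]] := k_ok l. Qed.
Let cQ_ok : regime_coefficient (cQ k).
Proof. by move=> l; have [_ []] := k_ok l. Qed.
Let cS_ok : regime_coefficient (cS k).
Proof. by move=> l; have [_ []] := k_ok l. Qed.
Let cR_ok : regime_coefficient (cR k).
Proof. by move=> l; have [_ []] := k_ok l. Qed.

Lemma L2F_mx_lin p q (c : Om -> R) (K : R) (f g : R -> Om -> 'M[R]_(p, q)) :
  rv_measurable (F t) c -> (forall w, `|c w| <= K) ->
  L2F_mx P F t T f -> L2F_mx P F t T g ->
  L2F_mx P F t T (fun s w => c w *: f s w + g s w).
Proof.
move=> mc cK L2f L2g i j.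
rewrite (_ : (fun s w => _) = fun s w => c w * f s w i j + g s w i j).
  exact: (L2F_lin tT filtWA_filtration mc cK).
by apply/funext => s; apply/funext => w; rewrite !mxE.
Qed.

Lemma admissible_L2 xi z : admissible xi z ->
  L2_process_mx z.1 /\ L2_process_mx z.2.
Proof. by move=> [u2 [X2 _ _ _]]; split; exact: L2F_mx_process. Qed.

Lemma drift_path_integrable xi z : admissible xi z ->
  {ae P, forall w, forall i, lebesgue_measure.-integrable `[t, T]
    (fun s => ((cA k s (beta s w) w *m z.2 s w
                + cB k s (beta s w) w *m z.1 s w) i 0)%:E)}.
Proof.
move=> /admissible_L2[u2 X2].
have iAX := mulmx_path_integrable cA_ok X2.
have iBu := mulmx_path_integrable cB_ok u2.
apply: filterS2 iAX iBu => w iA iB i.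
have := @integrableD _ _ _ lebesgue_measure _ (measurable_itv `[t, T]) _ _
  (iA i) (iB i).
by apply: eq_integrable => // s _; rewrite [in RHS]mxE EFinD.
Qed.

Lemma terminal_sqint xi z i : admissible xi z ->
  measurable_fun setT (fun w => z.2 T w i 0) /\
  rv_sqint P (fun w => z.2 T w i 0).
Proof.
move=> az; have [_ X2] := admissible_L2 az.
have [mX _] := X2 i 0; have [_ [_ sX _ _]] := az; split; last exact: sX.
exact: (jointly_measurable_section T_in mX).
Qed.

Let mulmx_lin p q (A : 'M[R]_(p, q)) c (x y : 'cV[R]_q) :
  A *m (c *: x + y) = c *: (A *m x) + A *m y.
Proof. by rewrite mulmxDr scalemxAr. Qed.

(** The state equation is linear and [c] is known at time [t]: it passes through
    the Ito integral by [ito_lin] and, path by path, through the drift integral,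
    the drift being integrable along almost every path. *)
Lemma admissible_lin (c : Om -> R) (K : R) xi xi' z z' :
  rv_measurable (F t) c -> (forall w, `|c w| <= K) ->
  admissible xi z -> admissible xi' z' ->
  admissible (fun w => c w *: xi w + xi' w) (combine c z z').
Proof.
move=> mc cK az az'.
have iz := drift_path_integrable az; have iz' := drift_path_integrable az'.
have [u2 [X2 sX cX [I [itoI eqX]]]] := az.
have [u2' [X2' sX' cX' [I' [itoI' eqX']]]] := az'.
have mc' := rv_measurable_fun F_sigma F_meas mc.
have [t0 _] := andP t_range.
split; first exact: (L2F_mx_lin mc cK u2 u2').
split.
- exact: (L2F_mx_lin mc cK X2 X2').
- move=> s i ts; rewrite /rv_sqint.
  have mXs (x : R -> Om -> 'cV[R]_n) : L2F_mx P F t T x ->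
      measurable_fun setT (fun w => x s w i 0).
    move=> /L2F_mx_process/(_ i 0)[mx _].
    exact: (jointly_measurable_section ts mx).
  under eq_integral do rewrite /= !mxE.
  apply: le_lt_trans (sqr_integral_lin P mc' cK (mXs _ X2) (mXs _ X2')) _.
  have K0 : 0 <= 2 * K ^+ 2 by rewrite mulr_ge0// sqr_ge0.
  by rewrite lte_add_pinfty// lte_mul_pinfty// ?lee_fin//;
    [exact: sX|exact: sX'].
- apply: filterS2 cX cX' => w cX cX' i s.
  rewrite (_ : (fun s => _) =
      fun s => c w * z.2 s w i 0 + z'.2 s w i 0); last first.
    by apply/funext => r; rewrite !mxE.
  by apply: cvgD; [apply: cvgM; [exact: cvg_cst|exact: cX]|exact: cX'].
exists (fun s w => c w *: I s w + I' s w); split.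
  move=> i.
  rewrite (_ : (fun s w => (c w *: I s w + I' s w) i 0) =
    fun s w => c w * I s w i 0 + I' s w i 0); last first.
    by apply/funext => s; apply/funext => w; rewrite !mxE.
  set D := (X in is_ito _ _ _ _ _ X _).
  rewrite (_ : D = fun s w =>
      c w *
        (cC k s (beta s w) w *m z.2 s w + cD k s (beta s w) w *m z.1 s w) i 0 +
      (cC k s (beta s w) w *m z'.2 s w + cD k s (beta s w) w *m z'.1 s w) i 0).
    apply: (ito_lin tT filtWA_filtration _ mc cK (itoI i) (itoI' i)).
    by move=> r /andP[tr rT]; apply: W_meas; rewrite (le_trans t0 tr).
  apply/funext => s; apply/funext => w; rewrite /D /= !mulmx_lin !mxE.
  by ring.
apply: filterS2 (filterI eqX eqX') (filterI iz iz').
move=> w [eX eX'] [iw iw'] s ts i.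
have [tls lsT] := andP ts.
rewrite /= !mxE eX// eX'//.
set D1 := (X in _ * (_ + X + _)); set D2 := (X in _ + (_ + X + _) = _).
have sub : [set` `[t, s]] `<=` [set` `[t, T]].
  by move=> r /=; rewrite !in_itv/= => /andP[-> rs]; rewrite (le_trans rs lsT).
have iS (f : R -> R) : lebesgue_measure.-integrable `[t, T] (EFin \o f) ->
    lebesgue_measure.-integrable `[t, s] (EFin \o f).
  by apply: integrableS => //; exact: measurable_itv.
have i1 := iS _ (iw i); have i2 := iS _ (iw' i).
rewrite (_ : Rintegral _ _ _ = c w * D1 + D2); first by ring.
rewrite /D1 /D2 -RintegralZl// -RintegralD//.
  by apply: eq_Rintegral => r _; rewrite !mulmx_lin !mxE; ring.
by apply: (@integrableZl _ _ _ lebesgue_measure _ (measurable_itv _) (c w) _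
  i1).
Qed.

Definition running_form (z z' : trajectory) (s : R) (w : Om) : R :=
  let i := beta s w in
  dotp (cQ k s i w *m z.2 s w) (z'.2 s w)
  + 2 * dotp (cS k s i w *m z.2 s w) (z'.1 s w)
  + dotp (cR k s i w *m z.1 s w) (z'.1 s w).

(** The running and terminal costs of a single trajectory, polarised without
    symmetrisation: the diagonal is then the pathwise cost on the nose, while
    [cost_form z z'] and [cost_form z' z] differ in the cross term [S] between
    states and controls. *)
Definition cost_form (z z' : trajectory) (w : Om) : R :=
  dotp (cG k (beta T w) w *m z.2 T w) (z'.2 T w)
  + \int[lebesgue_measure]_(s in `[t, T]) running_form z z' s w.

Lemma running_form_L1 xi xi' z z' : admissible xi z -> admissible xi' z' ->
  L1_process P t T (running_form z z').
Proof.
move=> /admissible_L2[u2 X2] /admissible_L2[u2' X2'].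
rewrite (_ : running_form z z' = fun s w =>
    2 * dotp (cS k s (beta s w) w *m z.2 s w) (z'.1 s w) +
    (1 * dotp (cQ k s (beta s w) w *m z.2 s w) (z'.2 s w) +
     dotp (cR k s (beta s w) w *m z.1 s w) (z'.1 s w))).
  apply: (@L1_process_lin _ _ _ _ _ _ (fun _ => 2) _ _ 2) => //.
  - by move=> _; rewrite ger0_norm.
  - exact: form_L1.
  apply: (@L1_process_lin _ _ _ _ _ _ (fun _ => 1) _ _ 1) => //.
  - by move=> _; rewrite normr1.
  - exact: form_L1.
  - exact: form_L1.
by apply/funext => s; apply/funext => w; rewrite /running_form; ring.
Qed.

Let cG_measurable i j : measurable_fun setT (fun w => cG k (beta T w) w i j).
Proof.
have [t0 _] := andP t_range.
have T0 : 0 <= T by exact: le_trans tT.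
rewrite (_ : (fun w => _) =
    fun w => \sum_l (beta T w == l)%:R * cG k l w i j); last first.
  by apply/funext => w; rewrite -regime_sum.
apply: measurable_sum => l; apply: measurable_funM.
  exact: (jointly_measurable_section T_in (regime_jointly_measurable l)).
have [_ _ [mG _] _ _] := k_ok l.
by apply: (adapted_measurable filtW_filtration _ (mG i j)); rewrite T0 lexx.
Qed.

Let cG_bounded i j : rv_bounded P (fun w => cG k (beta T w) w i j).
Proof.
have /choice[K bK] l : exists K, {ae P, forall w, `|cG k l w i j| <= K}.
  by have [_ _ [_ bG] _ _] := k_ok l; exact: bG.
exists (\sum_l `|K l|).
have := filter_forall (ae_filter_ringOfSetsType P) bK.
apply: filterS => w bw; apply: le_trans (bw (beta T w)) _.
by rewrite (bigD1 (beta T w))//= (le_trans (ler_norm _))// lerDl sumr_ge0.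
Qed.

Lemma cost_form_integrable xi xi' z z' : admissible xi z -> admissible xi' z' ->
  P.-integrable setT (EFin \o cost_form z z').
Proof.
move=> az az'.
apply: (@integrableD _ _ _ P setT measurableT
  (fun w => _%:E) (fun w => _%:E)); last first.
  exact: L1_process_integrable (running_form_L1 az az').
under eq_fun do rewrite dotp_mulmx -sumEFin.
apply: (integrable_sum measurableT) => i _.
under eq_fun do rewrite -sumEFin.
apply: (integrable_sum measurableT) => j _.
have [mX sX] := terminal_sqint j az; have [mX' sX'] := terminal_sqint i az'.
exact: rv_triple_integrable.
Qed.

(** The identity holds only almost surely, since the time integral is additive
    along the paths on which the running forms are integrable. *)
Lemma cost_form_linl xi1 xi2 xi' c z1 z2 z' :
  admissible xi1 z1 -> admissible xi2 z2 -> admissible xi' z' ->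
  {ae P, forall w, cost_form (combine c z1 z2) z' w =
                   c w * cost_form z1 z' w + cost_form z2 z' w}.
Proof.
move=> a1 a2 a'.
apply: filterS2 (L1_process_path_integrable (running_form_L1 a1 a'))
  (L1_process_path_integrable (running_form_L1 a2 a')) => w i1 i2.
rewrite /cost_form /= mulmx_lin dotpDl.
rewrite (_ : Rintegral _ _ _ =
    c w * (\int[lebesgue_measure]_(s in `[t, T]) running_form z1 z' s w) +
    \int[lebesgue_measure]_(s in `[t, T]) running_form z2 z' s w);
  first by ring.
rewrite -RintegralZl// -RintegralD//.
  apply: eq_Rintegral => s _.
  by rewrite /running_form /= !mulmx_lin !dotpDl; ring.
by apply: (@integrableZl _ _ _ lebesgue_measure _ (measurable_itv _) (c w) _
  i1).
Qed.

Lemma cost_form_linr xi1 xi2 xi' c z1 z2 z' :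
  admissible xi1 z1 -> admissible xi2 z2 -> admissible xi' z' ->
  {ae P, forall w, cost_form z' (combine c z1 z2) w =
                   c w * cost_form z' z1 w + cost_form z' z2 w}.
Proof.
move=> a1 a2 a'.
apply: filterS2 (L1_process_path_integrable (running_form_L1 a' a1))
  (L1_process_path_integrable (running_form_L1 a' a2)) => w i1 i2.
rewrite /cost_form /= ![dotp (_ *m _) _]dotpC dotpDl.
rewrite (_ : Rintegral _ _ _ =
    c w * (\int[lebesgue_measure]_(s in `[t, T]) running_form z' z1 s w) +
    \int[lebesgue_measure]_(s in `[t, T]) running_form z' z2 s w);
  first by ring.
rewrite -RintegralZl// -RintegralD//.
  apply: eq_Rintegral => s _.
  by rewrite /running_form /= ![dotp (_ *m _) _]dotpC !dotpDl; ring.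
by apply: (@integrableZl _ _ _ lebesgue_measure _ (measurable_itv _) (c w) _
  i1).
Qed.

Definition cost_version (z z' : trajectory) (Y : Om -> R) : Prop :=
  is_condexp P (F t) (cost_form z z') Y.

Lemma cost_version_linl xi1 xi2 xi' c (K : R) z1 z2 z' Y1 Y2 :
  rv_measurable (F t) c -> (forall w, `|c w| <= K) ->
  admissible xi1 z1 -> admissible xi2 z2 -> admissible xi' z' ->
  cost_version z1 z' Y1 -> cost_version z2 z' Y2 ->
  cost_version (combine c z1 z2) z' (fun w => c w * Y1 w + Y2 w).
Proof.
move=> mc cK a1 a2 a' v1 v2.
apply: (condexp_ae F_meas (condexp_linear F_sigma F_meas mc cK v1 v2)).
  exact: cost_form_integrable (admissible_lin mc cK a1 a2) a'.
by apply: filterS (cost_form_linl c a1 a2 a') => w ->.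
Qed.

Lemma cost_version_linr xi1 xi2 xi' c (K : R) z1 z2 z' Y1 Y2 :
  rv_measurable (F t) c -> (forall w, `|c w| <= K) ->
  admissible xi1 z1 -> admissible xi2 z2 -> admissible xi' z' ->
  cost_version z' z1 Y1 -> cost_version z' z2 Y2 ->
  cost_version z' (combine c z1 z2) (fun w => c w * Y1 w + Y2 w).
Proof.
move=> mc cK a1 a2 a' v1 v2.
apply: (condexp_ae F_meas (condexp_linear F_sigma F_meas mc cK v1 v2)).
  exact: cost_form_integrable a' (admissible_lin mc cK a1 a2).
by apply: filterS (cost_form_linr c a1 a2 a') => w ->.
Qed.

Lemma cost_version_exists xi xi' z z' : admissible xi z -> admissible xi' z' ->
  exists Y, cost_version z z' Y.
Proof.
move=> az az'; apply: condexp_exists F_sigma F_meas _ _.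
exact: cost_form_integrable az az'.
Qed.

Let rv_measurable_cst (x : R) : rv_measurable (F t) (fun _ => x).
Proof. exact: measurable_cst. Qed.

(** Written as a combination of a trajectory with itself, the zero trajectory
    inherits admissibility and its cost from the linearity lemmas; it is the
    empty superposition. *)
Definition zero_trajectory : trajectory := (fun _ _ => 0, fun _ _ => 0).

Let zero_trajectoryE z : combine (fun _ => -1) z z = zero_trajectory.
Proof.
by congr pair; apply/funext => s; apply/funext => w; rewrite scaleN1r addNr.
Qed.

Lemma admissible_zero xi z : admissible xi z ->
  admissible (fun _ => 0) zero_trajectory.
Proof.
move=> az; rewrite -(zero_trajectoryE z).
rewrite (_ : (fun _ => 0) = fun w => -1 *: xi w + xi w); last first.
  by apply/funext => w; rewrite scaleN1r addNr.
apply: (admissible_lin (c := fun _ => -1) (K := 1)) => //.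
by move=> _; rewrite normrN1.
Qed.

Lemma cost_version_zero xi z : admissible xi z ->
  cost_version zero_trajectory z (fun _ => 0) /\
  cost_version z zero_trajectory (fun _ => 0).
Proof.
move=> az; have [Y vY] := cost_version_exists az az.
rewrite -(zero_trajectoryE z).
rewrite (_ : (fun _ => 0) = fun w => -1 * Y w + Y w); last first.
  by apply/funext => w; rewrite mulN1r addNr.
have n1 (w : Om) : `|(-1 : R)| <= 1 by rewrite normrN1.
split.
- exact: (cost_version_linl (rv_measurable_cst (-1)) n1 az az az).
- exact: (cost_version_linr (rv_measurable_cst (-1)) n1 az az az).
Qed.

Definition superpose (I : Type) (r : seq I) (c : I -> Om -> R)
    (z : I -> trajectory) : trajectory :=
  foldr (fun i => combine (c i) (z i)) zero_trajectory r.

Section Superposition.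
Variables (I : Type) (c : I -> Om -> R) (K : R) (z : I -> trajectory).
Variables (xi : I -> Om -> 'cV[R]_n).
Hypothesis c_meas : forall i, rv_measurable (F t) (c i).
Hypothesis c_bounded : forall i w, `|c i w| <= K.
Hypothesis z_admissible : forall i, admissible (xi i) (z i).

Lemma admissible_superpose (r : seq I) :
  admissible (fun _ => 0) zero_trajectory ->
  admissible (fun w => \sum_(i <- r) c i w *: xi i w) (superpose r c z).
Proof.
move=> a0; elim: r => [|i r IH] /=.
  by under eq_fun do rewrite big_nil.
under eq_fun do rewrite big_cons.
exact: (admissible_lin (c_meas i) (c_bounded i) (z_admissible i) IH).
Qed.

Lemma cost_version_superposel (r : seq I) xi' z' (Y : I -> Om -> R) :
  admissible xi' z' -> (forall i, cost_version (z i) z' (Y i)) ->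
  cost_version (superpose r c z) z' (fun w => \sum_(i <- r) c i w * Y i w).
Proof.
move=> a' vY; elim: r => [|i r IH] /=.
  under eq_fun do rewrite big_nil.
  exact: (proj1 (cost_version_zero a')).
under eq_fun do rewrite big_cons.
have ar := admissible_superpose r (admissible_zero a').
exact: (cost_version_linl (c_meas i) (c_bounded i) (z_admissible i) ar a'
  (vY i) IH).
Qed.

Lemma cost_version_superposer (r : seq I) xi' z' (Y : I -> Om -> R) :
  admissible xi' z' -> (forall i, cost_version z' (z i) (Y i)) ->
  cost_version z' (superpose r c z) (fun w => \sum_(i <- r) c i w * Y i w).
Proof.
move=> a' vY; elim: r => [|i r IH] /=.
  under eq_fun do rewrite big_nil.
  exact: (proj2 (cost_version_zero a')).
under eq_fun do rewrite big_cons.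
have ar := admissible_superpose r (admissible_zero a').
exact: (cost_version_linr (c_meas i) (c_bounded i) (z_admissible i) ar a'
  (vY i) IH).
Qed.

End Superposition.

Local Notation value := (is_value P T W alpha al k t).

Lemma value_le xi V z Y : value xi theta V -> admissible xi z ->
  cost_version z z Y -> {ae P, forall w, (V w <= (Y w)%:E)%E}.
Proof.
move=> [_ + _] [uz Xz] vY; apply.
by exists z.1; split => //; exists z.2.
Qed.

(** The trajectory [z + x z0] competes with [z] for every real [x], and its
    conditional cost exceeds that of [z] by [x^2 Y0 + x (Y1 + Y2)]. *)
Lemma optimal_first_order xi z z0 J Y1 Y2 Y0 :
  value xi theta (EFin \o J) -> admissible xi z -> cost_version z z J ->
  admissible (fun _ => 0) z0 ->
  cost_version z z0 Y1 -> cost_version z0 z Y2 -> cost_version z0 z0 Y0 ->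
  {ae P, forall w, Y1 w + Y2 w = 0 /\ 0 <= Y0 w}.
Proof.
move=> vJ az vz az0 v1 v2 v0.
have perturb (x : R) : {ae P, forall w, 0 <= x ^+ 2 * Y0 w + x * (Y1 w + Y2 w)}.
  have xx (w : Om) : `|x| <= `|x| by [].
  have mx := rv_measurable_cst x.
  have ax : admissible xi (combine (fun _ => x) z0 z).
    rewrite (_ : xi = fun w => x *: 0 + xi w).
      exact: admissible_lin mx xx az0 az.
    by apply/funext => w; rewrite scaler0 add0r.
  have vx0 := cost_version_linr mx xx az0 az az0 v0 v2.
  have vx := cost_version_linr mx xx az0 az az v1 vz.
  have := value_le vJ ax (cost_version_linl mx xx az0 az ax vx0 vx).
  apply: filterS => w /=; rewrite lee_fin -subr_ge0 => h.
  rewrite (_ : _ + _ = x * (x * Y0 w + Y2 w) + (x * Y1 w + J w) - J w)//.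
  by ring.
have /ae_foralln pos := fun i : nat => perturb i.+1%:R^-1.
have /ae_foralln neg := fun i : nat => perturb (- i.+1%:R^-1).
apply: filterS2 pos neg => w pw nw.
apply: linear_term0 => i; first exact: pw.
by have := nw i; rewrite sqrrN mulNr.
Qed.

Section QuadraticValue.
Hypothesis n_gt0 : (0 < n)%N.
Variables (z : 'I_n -> trajectory) (J : 'I_n -> Om -> R).
Variable Y : 'I_n -> 'I_n -> Om -> R.
Hypothesis z_admissible : forall i, admissible (fun _ => delta_mx i 0) (z i).
Hypothesis z_cost : forall i, cost_version (z i) (z i) (J i).
Hypothesis z_optimal :
  forall i, value (fun _ => delta_mx i 0) theta (EFin \o J i).
Hypothesis Y_version : forall i j, cost_version (z i) (z j) (Y i j).

(** The stated variable is the conditional cost of the superposition of the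
    optimal trajectories with coefficients [c].  In the cost of any competitor
    the cross terms with this superposition vanish and the remaining term is
    nonnegative, by [optimal_first_order]. *)
Lemma value_quadratic (c : 'I_n -> Om -> R) (K : R) :
  (forall i, rv_measurable (F t) (c i)) -> (forall i w, `|c i w| <= K) ->
  value (fun w => \sum_i c i w *: delta_mx i 0) theta
    (fun w => (\sum_i c i w * \sum_j c j w * Y i j w)%:E).
Proof.
move=> mc cK; set xi := fun w => _.
pose V w := \sum_i c i w * \sum_j c j w * Y i j w.
rewrite -[X in value _ _ X]/(EFin \o V).
have a0 := admissible_zero (z_admissible (Ordinal n_gt0)).
pose zeta := superpose (index_enum 'I_n) c z.
have azeta : admissible xi zeta.
  exact: admissible_superpose mc cK z_admissible _ a0.
have vzeta : cost_version zeta zeta V.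
  apply: (cost_version_superposel mc cK z_admissible _ azeta) => i.
  exact: (cost_version_superposer mc cK z_admissible (index_enum 'I_n)
    (z_admissible i) (Y_version i)).
have [_ iV _ _] := vzeta.
split.
- exact: measurable_int iV.
- move=> Jv [u [cu [X [sX vJv]]]].
  pose v : trajectory := (u, X).
  have av : admissible xi v by split.
  have n1 (w : Om) : `|(-1 : R)| <= 1 by rewrite normrN1.
  have p1 (w : Om) : `|(1 : R)| <= 1 by rewrite normr1.
  pose z0 := combine (fun _ => -1) zeta v.
  have az0 : admissible (fun _ => 0) z0.
    rewrite (_ : (fun _ => 0) = fun w => -1 *: xi w + xi w).
      exact: admissible_lin (rv_measurable_cst (-1)) n1 azeta av.
    by apply/funext => w; rewrite scaleN1r addNr.
  have vE : v = combine (fun _ => 1) zeta z0.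
    by congr pair; apply/funext => s; apply/funext => w /=;
      rewrite scale1r scaleN1r addNKr.
  have /choice[Y1 v1] i := cost_version_exists (z_admissible i) az0.
  have /choice[Y2 v2] i := cost_version_exists az0 (z_admissible i).
  have [Y0 v0] := cost_version_exists az0 az0.
  have vz0 := cost_version_superposel mc cK z_admissible (index_enum _) az0 v1.
  have v0z := cost_version_superposer mc cK z_admissible (index_enum _) az0 v2.
  have m1 := rv_measurable_cst 1.
  have av' : admissible xi (combine (fun _ => 1) zeta z0) by rewrite -vE.
  (* Expansion of the cost of [zeta + z0] into its four terms. *)
  have vv := cost_version_linl m1 p1 azeta az0 av'
    (cost_version_linr m1 p1 azeta az0 azeta vzeta vz0)
    (cost_version_linr m1 p1 azeta az0 az0 v0z v0).
  rewrite -vE in vv.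
  have eqJ := condexp_uniq F_sigma F_meas vJv vv (aeW P (fun _ => erefl)).
  have foc : {ae P, forall w i, Y1 i w + Y2 i w = 0 /\ 0 <= Y0 w}.
    apply: filter_forall => i.
    exact: optimal_first_order (z_optimal i) (z_admissible i) (z_cost i) az0
      (v1 i) (v2 i) v0.
  apply: filterS2 eqJ foc => w -> Yw; rewrite lee_fin !mul1r.
  have Y00 : 0 <= Y0 w by have [] := Yw (Ordinal n_gt0).
  have cross : \sum_i c i w * Y1 i w + \sum_i c i w * Y2 i w = 0.
    by rewrite -big_split/= big1// => i _; rewrite -mulrDr (Yw i).1 mulr0.
  by rewrite addrA -[V w + _ + _]addrA cross addr0 lerDl.
- move=> Z mZ Zle; apply: Zle; exists zeta.1; split; first by have [] := azeta.
  by exists zeta.2; split; first by have [] := azeta.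
Qed.

End QuadraticValue.

(** The initial state enters the state equation only through an almost sure
    identity. *)
Lemma is_state_ae xi xi' u X : {ae P, forall w, xi w = xi' w} ->
  is_state P T W alpha al k t xi theta u X ->
  is_state P T W alpha al k t xi' theta u X.
Proof.
move=> xixi' [X2 sX cX [I [itoI eqX]]]; split => //; exists I; split => //.
by apply: filterS2 xixi' eqX => w <-.
Qed.

Lemma is_value_ae xi xi' V V' : {ae P, forall w, xi w = xi' w} ->
  {ae P, forall w, V w = V' w} -> measurable_fun setT V' ->
  value xi theta V -> value xi' theta V'.
Proof.
move=> xixi' VV' mV' [mV Vle leV].
have xi'xi : {ae P, forall w, xi' w = xi w} by apply: filterS xixi' => w ->.
have cost_ae x x' u J : {ae P, forall w, x w = x' w} ->
    is_cost P T W alpha al k t x theta u J ->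
    is_cost P T W alpha al k t x' theta u J.
  by move=> xx' [X [sX cX]]; exists X; split => //; exact: is_state_ae xx' sX.
split => //.
- move=> J [u [cu cJ]].
  have := Vle J (ex_intro _ u (conj cu (cost_ae _ _ _ _ xi'xi cJ))).
  by apply: filterS2 VV' => w ->.
- move=> Z mZ Zle; apply: filterS2 VV' (leV Z mZ _) => [w <- //|J [u [cu cJ]]].
  by apply: Zle; exists u; split => //; exact: cost_ae cJ.
Qed.

End LinearQuadratic.

(** * Representation of the value flow *)

(** The indicator of the event is integrable, being the variable whose
    conditional expectation the Markov property describes. *)
Lemma markov_chain_measurable (R : realType) (d : measure_display)
    (Om : measurableType d) (P : probability Om R) Fl (t0 T : R) (L : nat)
    (tp : R -> R -> 'I_L -> 'I_L -> R) (beta : R -> Om -> 'I_L) s l :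
  markov_chain P Fl t0 T tp beta -> t0 <= s <= T ->
  measurable (beta s @^-1` [set l]).
Proof.
move=> [_ chain _] /andP[t0s sT].
have [iZ _ _ _] := chain s s l t0s (lexx s) sT.
have /measurable_EFinP mZ := measurable_int _ iZ.
rewrite (_ : _ @^-1` _ = (fun w => (beta s w == l)%:R : R) @^-1` [set 1]).
  by rewrite -[X in measurable X]setTI; apply: mZ.
apply/seteqP; split => w /= => [->|]; first by rewrite eqxx.
by case: eqP => // _ /esym/eqP; rewrite oner_eq0.
Qed.

(** The truncation at the essential bound is a measurable function of [f], hence
    still measurable for [G]. *)
Lemma bounded_modification (R : realType) (d : measure_display)
    (Om : measurableType d) (P : probability Om R) (G : set (set Om))
    (f : Om -> R) :
  rv_measurable G f -> rv_bounded P f ->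
  exists (g : Om -> R) (K : R), [/\ rv_measurable G g,
    forall w, `|g w| <= K & {ae P, forall w, g w = f w}].
Proof.
move=> mf [K fK].
exists (fun w => f w * \1_(`[- `|K|, `|K|]%classic) (f w)), `|K|; split.
- apply: measurable_funM => //.
  exact: (@measurableT_comp _ _ _ (g_sigma_algebraType G) R R
    (\1_(`[- `|K|, `|K|]%classic)) setT f).
- move=> w; rewrite indicE mem_setE in_itv/= -ler_norml.
  by case: (boolP (`|f w| <= _)) => [fw|_]; rewrite ?mulr1// mulr0 normr0.
- apply: filterS fK => w fw; rewrite indicE mem_setE in_itv/= -ler_norml.
  by rewrite (le_trans fw (ler_norm K)) mulr1.
Qed.

Lemma sum_scale_delta (R : realType) n (x : 'cV[R]_n) :
  \sum_i x i 0 *: delta_mx i 0 = x.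
Proof.
apply/matrixP => i j; rewrite ord1 summxE (bigD1 i)//= big1 ?addr0.
  by rewrite !mxE !eqxx mulr1.
by move=> l li; rewrite !mxE eq_sym (negbTE li) mulr0.
Qed.

Lemma symmetrized_form (R : realType) n (Y : 'I_n -> 'I_n -> R)
    (c : 'I_n -> R) :
  \sum_i \sum_j 2^-1 * (Y i j + Y j i) * c j * c i =
  \sum_i c i * \sum_j c j * Y i j.
Proof.
have -> : \sum_i c i * \sum_j c j * Y i j = \sum_i \sum_j c i * (c j * Y i j).
  by apply: eq_bigr => i _; rewrite big_distrr.
set S := RHS; transitivity (2^-1 * (S + S)); last by field.
have SE : S = \sum_i \sum_j c j * (c i * Y j i) by rewrite /S exchange_big.
rewrite {2}SE /S -big_split mulr_sumr; apply: eq_bigr => i _ /=.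
by rewrite -big_split mulr_sumr; apply: eq_bigr => j _ /=; ring.
Qed.

Theorem theorem3p11 (R : realType) (d : measure_display)
    (Om : measurableType d) (P : probability Om R)
    (T : R) (n m L : nat)
    (W : R -> Om -> R) (alpha : R -> Om -> 'I_L)
    (lam : 'I_L -> 'I_L -> R -> R) (tp : R -> R -> 'I_L -> 'I_L -> R)
    (al : R -> (Om -> 'I_L) -> R -> Om -> 'I_L)
    (k : @coefficients R d Om n m L)
    (T_gt0 : 0 < T) (n_gt0 : (0 < n)%N) (m_gt0 : (0 < m)%N) (L_gt0 : (0 < L)%N)
    (P_complete : measure_is_complete P)
    (W_brownian : brownian_motion P T W)
    (tp_generator : transition_function T lam tp)
    (alpha_chain : markov_chain P (filtA P alpha) 0 T tp alpha)
    (W_alpha_indep :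
      independent_filtrations P T (filtW P W) (filtA P alpha))
    (al_alpha : restarts_chain P T alpha al)
    (k_ok : admissible_coefficients P T (filtW P W) k)
    (t : R) (t_range : 0 <= t <= T)
    (theta : Om -> 'I_L) (theta_init : initial_regime P T alpha tp al t theta)
    (solv : solvable_at P T W alpha tp al k t) :
  exists Pr : R -> 'I_L -> Om -> 'M[R]_n,
    [/\ forall s i w, 0 <= s <= T -> (Pr s i w)^T = Pr s i w,
        forall i, adapted_mx (filtWA P W alpha) 0 T (Pr ^~ i) &
        forall xi : Om -> 'cV[R]_n,
          rv_measurable_mx (filtWA P W alpha t) xi -> rv_bounded_mx P xi ->
          is_value P T W alpha al k t xi theta
            (fun w => (dotp (Pr t (theta w) w *m xi w) (xi w))%:E)].
Proof.
have W_meas s : 0 <= s <= T -> measurable_fun setT (W s).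
  by have [+ _ _ _ _] := W_brownian; exact.
have alpha_meas s l : 0 <= s <= T -> measurable (alpha s @^-1` [set l]).
  exact: markov_chain_measurable alpha_chain.
have [theta_meas [regime_prog _ _] _] := theta_init.
have value_quad := value_quadratic P_complete W_meas alpha_meas k_ok t_range
  regime_prog n_gt0.
have /choice[u u_opt] : forall i : 'I_n, exists u,
    optimal P T W alpha al k t (fun _ => delta_mx i 0) theta u.
  move=> i; apply: solv; split => //; split.
    by move=> a b; exact: measurable_cst.
  move=> a; rewrite /rv_sqint integral_cst//=.
  by rewrite probability_setT mule1 ltry.
have /choice[X X_opt] : forall i, exists X,
    admissible P T W alpha al k t theta (fun _ => delta_mx i 0) (u i, X) /\
    exists J, cost_version P T W alpha al k t theta (u i, X) (u i, X) J /\
      is_value P T W alpha al k t (fun _ => delta_mx i 0) theta (EFin \o J).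
  move=> i; have [cu [J [[X [sX vJ]] oJ]]] := u_opt i.
  by exists X; split; [split|exists J].
pose z i := (u i, X i).
have z_adm i :
    admissible P T W alpha al k t theta (fun _ => delta_mx i 0) (z i).
  by have [] := X_opt i.
have /choice[J J_opt] i := (X_opt i).2.
have /choice[Y0 Y_version] : forall ij : 'I_n * 'I_n, exists Y,
    cost_version P T W alpha al k t theta (z ij.1) (z ij.2) Y.
  move=> ij; exact: (cost_version_exists P_complete W_meas alpha_meas k_ok
    t_range regime_prog (z_adm ij.1) (z_adm ij.2)).
pose Y i j := Y0 (i, j).
have Y_meas i j : rv_measurable (filtWA P W alpha t) (Y i j).
  by have [] := Y_version (i, j).
(* The representation concerns the given time [t] and regime [theta], for which
   the basis trajectories [z] were chosen: the process is symmetrised at time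
   [t], the same for all regimes, and 0 at other times. *)
pose Pr s (l : 'I_L) w : 'M[R]_n :=
  if s == t then \matrix_(i, j) (2^-1 * (Y i j w + Y j i w)) else 0.
exists Pr; split.
- move=> s l w _; rewrite /Pr; case: ifP => _; last exact: trmx0.
  by apply/matrixP => i j; rewrite !mxE addrC.
- move=> l s _ i j; rewrite /Pr; case: eqP => [->|_]; last first.
    by under eq_fun do rewrite mxE; exact: measurable_cst.
  under eq_fun do rewrite mxE.
  apply: measurable_funM; first exact: measurable_cst.
  by apply: measurable_funD; exact: Y_meas.
move=> xi xi_meas xi_bounded.
have /choice[c /choice[K cK]] i :=
  bounded_modification (xi_meas i 0) (xi_bounded i 0).
have c_meas i : rv_measurable (filtWA P W alpha t) (c i) by have [] := cK i.
have c_bounded i w : `|c i w| <= \sum_j `|K j|.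
  have [_ /(_ w) cw _] := cK i.
  rewrite (le_trans cw)// (le_trans (ler_norm _))// (bigD1 i)//= lerDl.
  exact: sumr_ge0.
have c_xi : {ae P, forall w i, c i w = xi w i 0}.
  by apply: filter_forall => i; have [] := cK i.
have := value_quad z J Y z_adm (fun i => (J_opt i).1) (fun i => (J_opt i).2)
  (fun i j => Y_version (i, j)) c _ c_meas c_bounded.
have rv_fun (f : Om -> R) :
    rv_measurable (filtWA P W alpha t) f -> measurable_fun setT f.
  apply: (adapted_measurable (s := t)
    (filtWA_filtration P_complete W_meas alpha_meas t_range)).
  by rewrite lexx; case/andP: t_range.
have Y_fun i j := rv_fun _ (Y_meas i j).
have xi_fun i := rv_fun _ (xi_meas i 0).
apply: is_value_ae.
- apply: filterS c_xi => w cw; rewrite -[RHS]sum_scale_delta.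
  by apply: eq_bigr => i _; rewrite cw.
- apply: filterS c_xi => w cw; congr EFin.
  rewrite /Pr eqxx dotp_mulmx -symmetrized_form.
  by apply: eq_bigr => i _; apply: eq_bigr => j _; rewrite mxE !cw.
apply/measurable_EFinP; rewrite /Pr eqxx.
under eq_fun do rewrite dotp_mulmx.
apply: measurable_sum => i; apply: measurable_sum => j.
under eq_fun do rewrite mxE.
apply: measurable_funM => //; apply: measurable_funM => //.
apply: measurable_funM => //; apply: measurable_funD; exact: Y_fun.
Qed.
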